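(* Let $\mathcal G$ be a connected compact metric graph, let $\mathcal V^D\subseteq\mathcal V$ be a nonempty set of degree-one vertices, and let $1<p<\infty$. Then the $p$-torsional rigidity admits the variational characterization $$T_p(\mathcal G,\mathcal V^D)=\sup_{u\in W^{1,p}_{\mathcal V^D}(\mathcal G),\; u\not\equiv 0}\frac{\left(\int_{\mathcal G}|u|\,dx\right)^p}{\int_{\mathcal G}|u'|^p\,dx}.$$ Moreover, a function $u\in W^{1,p}_{\mathcal V^D}(\mathcal G)\setminus\{0\}$ attains the supremum if and only if it is a nonzero scalar multiple of the $p$-torsion function $w_p$.
   Context: A compact metric graph $\mathcal G$ is obtained from a finite combinatorial graph with vertex set $\mathcal V$ and finite edge set $\mathcal E$ by identifying the endpoints of compact intervals $[0,\ell_e]$, $\ell_e>0$, $e\in\mathcal E$, according to the graph structure; $|\mathcal G|=\sum_{e}\ell_e$. $\mathcal E_v$ is the set of edges incident with $v$ (a loop at $v$ counted twice, once for each endpoint) and $\deg(v)=|\mathcal E_v|$. Set $\mathcal V^N=\mathcal V\setminus\mathcal V^D$. $u_e$ denotes the restriction of $u$ to $e$. $W^{1,p}(\mathcal G)$ is the space of $u:\mathcal G\to\mathbb R$ with $u|_e\in W^{1,p}(0,\ell_e)$ for all $e\in\mathcal E$ and $u$ continuous at every vertex; $W^{1,p}_{\mathcal V^D}(\mathcal G)=\{u\in W^{1,p}(\mathcal G): u(v)=0\ \forall v\in\mathcal V^D\}$. Integrals over $\mathcal G$ are sums of integrals over edges. The $p$-torsion function $w_p$ is the unique function in $W^{1,p}_{\mathcal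 V^D}(\mathcal G)$ with $-(|w_{p,e}'|^{p-2}w_{p,e}')'=1$ on each edge $e$, $w_p(v)=0$ for $v\in\mathcal V^D$, and $\sum_{e\in\mathcal E_v}|w_{p,e}'(v)|^{p-2}\partial_{\nu_e}w_{p,e}(v)=0$ for $v\in\mathcal V^N$, where $\partial_{\nu_e}$ is the derivative at $v$ in the outward direction along $e$ (pointing from $v$ into $e$). Equivalently, $\int_{\mathcal G}|w_p'|^{p-2}w_p'\phi'\,dx=\int_{\mathcal G}\phi\,dx$ for all $\phi\in W^{1,p}_{\mathcal V^D}(\mathcal G)$. The $p$-torsional rigidity is defined by $T_p(\mathcal G,\mathcal V^D)=\bigl(\int_{\mathcal G}w_p\,dx\bigr)^{p-1}$. *)

(* Defs.v *)
From HB Require Import structures.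
From mathcomp Require Import all_boot all_order all_algebra.
From mathcomp Require Import all_classical all_reals all_analysis.

Set Implicit Arguments.
Unset Strict Implicit.
Unset Printing Implicit Defensive.

Import Order.TTheory GRing.Theory Num.Theory.
Import numFieldNormedType.Exports.

Local Open Scope classical_set_scope.
Local Open Scope ring_scope.

(* Loops and multiple edges are allowed.  The edge e is the interval
   [0, len e], with 0 glued to src e and len e glued to tgt e; the orientation
   only serves to parametrize the edge. *)
Record metric_graph (R : realType) := MetricGraph {
  vertex : finType;
  edge : finType;
  src : edge -> vertex;
  tgt : edge -> vertex;
  len : edge -> R;
  len_gt0 : forall e, 0 < len e }.

Section MetricGraph.
Context {R : realType} (G : metric_graph R).

Definition adjacent : rel (vertex G) := fun v w =>
  [exists e : edge G, ((src e == v) && (tgt e == w)) ||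
                      ((src e == w) && (tgt e == v))].

Definition connected_graph : Prop := forall v w, connect adjacent v w.

Definition degree (v : vertex G) : nat :=
  (#|[set e : edge G | src e == v]%SET| +
   #|[set e : edge G | tgt e == v]%SET|)%N.

(* In the quotient of the disjoint union of the intervals [0, len e] by the
   identification of their endpoints, every class is either a vertex or
   a single interior point of a single edge. *)
Inductive graph_point :=
| Vertex of vertex G
| Interior (e : edge G) of {x : R | 0 < x < len e}.

(* The gluing map [0, len e] -> G; the values at x < 0 and at x > len e are
   irrelevant. *)
Definition edge_pt (e : edge G) (x : R) : graph_point :=
  if insub x is Some y then @Interior e y
  else Vertex (if x <= 0 then src e else tgt e).

Definition restr (u : graph_point -> R) (e : edge G) (x : R) : R :=
  u (edge_pt e x).

(* The integrand is given edgewise, because weak derivatives are neither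
   defined at the vertices nor independent of the orientation. *)
Definition integral_graph (f : edge G -> R -> R) : R :=
  \sum_(e : edge G)
    (\int[lebesgue_measure]_(x in (`]0, len e[ : set R)) f e x)%R.

End MetricGraph.

Section Sobolev.
Context {R : realType}.
Implicit Types (p l : R) (f g phi : R -> R).

(* L^p(0, l), through extension by zero. *)
Definition Lp_itv p l f : Prop :=
  f \_ (`]0, l[ : set R) \in Lfun (@lebesgue_measure R) p%:E.

(* C^1_c(0, l), which yields the same weak derivatives as C^oo_c(0, l). *)
Definition test_function l phi : Prop :=
  [/\ forall x, derivable phi x 1,
      continuous (derive1 phi),
      compact (closure [set x | phi x != 0]) &
      closure [set x | phi x != 0] `<=` (`]0, l[ : set R)].

Definition is_weak_derivative l f g : Prop :=
  forall phi, test_function l phi ->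
    (\int[lebesgue_measure]_(x in (`]0, l[ : set R)) (f x * derive1 phi x) =
     - \int[lebesgue_measure]_(x in (`]0, l[ : set R)) (g x * phi x))%R.

Definition sobolev_itv p l f : Prop :=
  Lp_itv p l f /\ exists g, Lp_itv p l g /\ is_weak_derivative l f g.

(* Some L^p representative of the weak derivative, which is unique almost
   everywhere; meaningful for f in W^{1,p}(0, l). *)
Definition weak_derivative p l f : R -> R :=
  xget (cst 0) [set g | Lp_itv p l g /\ is_weak_derivative l f g].

End Sobolev.

Section PLaplacian.
Context {R : realType} (G : metric_graph R) (VD : {set vertex G}) (p : R).
Implicit Types u w : graph_point G -> R.

(* W^{1,p}(G).  As elements of W^{1,p}(0, len e) are identified with their
   continuous representatives on [0, len e], and u has a single value at each
   vertex, continuity on every closed edge includes continuity at the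
   vertices. *)
Definition sobolev u : Prop :=
  forall e : edge G,
    sobolev_itv p (len e) (restr u e) /\
    {within (`[0, len e] : set R), continuous (restr u e)}.

Definition sobolev_dirichlet u : Prop :=
  sobolev u /\ forall v, v \in VD -> u (Vertex v) = 0.

Definition energy u : R :=
  integral_graph (fun e x => `|weak_derivative p (len e) (restr u e) x| `^ p).

Definition torsion_quotient u : R :=
  (integral_graph (fun e x => `|restr u e x|)) `^ p / energy u.

(* |t|^(p-2) t, with value 0 at t = 0 also when p < 2. *)
Definition pflux (t : R) : R := `|t| `^ (p - 2) * t.

(* Difference quotients at the two ends of an edge, in the direction pointing
   from the vertex into the edge. *)
Definition src_quotient u (e : edge G) (h : R) : R :=
  (restr u e h - restr u e 0) / h.
Definition tgt_quotient u (e : edge G) (h : R) : R :=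
  (restr u e (len e - h) - restr u e (len e)) / h.

Definition kirchhoff u (v : vertex G) : Prop :=
  \sum_(e : edge G | src e == v) pflux (lim (src_quotient u e h @[h --> 0^'+]))
  + \sum_(e : edge G | tgt e == v)
      pflux (lim (tgt_quotient u e h @[h --> 0^'+])) = 0.

Definition is_torsion_function w : Prop :=
  [/\ sobolev_dirichlet w,
      forall (e : edge G) (x : R), 0 < x < len e ->
        derivable (restr w e) x 1 /\
        is_derive x 1 (fun y => pflux (derive1 (restr w e) y)) (-1),
      forall e : edge G,
        cvg (src_quotient w e h @[h --> 0^'+]) /\
        cvg (tgt_quotient w e h @[h --> 0^'+]) &
      forall v, v \notin VD -> kirchhoff w v].

(* T_p(G, V^D), given the p-torsion function w *)
Definition torsional_rigidity w : R :=
  (integral_graph (restr w)) `^ (p - 1).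

End PLaplacian.

(* Main.v *)
Require Import Defs.
From mathcomp Require Import all_boot all_order all_algebra.
From mathcomp Require Import all_classical all_reals all_analysis.
From mathcomp Require Import measurable_realfun ring lra.
Set Implicit Arguments.
Unset Strict Implicit.
Unset Printing Implicit Defensive.
Import Order.TTheory GRing.Theory Num.Theory.
Import numFieldNormedType.Exports.
Local Open Scope classical_set_scope.
Local Open Scope ring_scope.

(* On an edge the flux [|w'|^(p-2) w'] of the torsion function is affine,
   [x |-> a - x].  Integrating [((a - x) |u|)'] over the edges and using the
   Kirchhoff conditions at the vertices gives [int |u| <= int |w'|^(p-1) |u'|],
   with equality for [u = w].  Young's inequality turns this into
   [lam int |u| <= lam^p / p int |u'|^p + (1 - 1/p) int w], and the best [lam]
   gives the bound on the quotient.  In the case of equality [lam |u'| = |w'|]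
   almost everywhere, and the function [D = lam |u| - w] satisfies
   [(a - x) D' = 0] on each edge; hence [lam |u| = w], first for [u = w], which
   shows [w >= 0].  Finally [w > 0] outside the Dirichlet set, whose vertices
   do not separate the graph, so that [u] has a constant sign. *)

(** For a weakly differentiable [u] the derivative of [(a - x) |u|] makes sense only almost
    everywhere, and its sign alone does not control the function. The proof therefore works with
    increments. Testing the weak derivative with differences of C^1 steps gives [u y - u x] as an
    integral. A function whose increments over [[x, y]] are at most [C (y - x) (M y - M x)] is
    nonincreasing, because such second-order errors vanish under repeated halving. Integration by
    parts, its version for [|u|] and the rigidity [(a - x) D' = 0] are all derived in this way.
    [weak_derivative] is an arbitrary representative, so for multiples of [w] it is matched with the
    classical derivative only almost everywhere, by Lebesgue differentiation. The parameter [lam]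
    ranges over all nonnegative values: [lam = 1] with [u = w] gives [w >= 0], [lam = 0] excludes
    [int w = 0], and a positive value treats a general [u]. *)

(** * Primitives of integrable functions on the line *)

Section Primitive.
Context {R : realType}.
Local Notation mu := (@lebesgue_measure R).
Local Notation summable f := (mu.-integrable setT (EFin \o f)).
Implicit Types (f g : R -> R) (x y c : R).

Definition prim f x : R := (\int[mu]_(t in (`]-oo, x] : set R)) f t)%R.

Lemma summableS f (A : set R) : measurable A -> summable f ->
  mu.-integrable A (EFin \o f).
Proof. by move=> mA; apply: integrableS. Qed.

Lemma summableD f g : summable f -> summable g -> summable (fun x => f x + g x).
Proof. by move=> sf sg; exact: (integrableD measurableT sf sg). Qed.

Lemma summableB f g : summable f -> summable g -> summable (fun x => f x - g x).
Proof. by move=> sf sg; exact: (integrableB measurableT sf sg). Qed.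

Lemma summableZ c f : summable f -> summable (fun x => c * f x).
Proof. by move=> sf; exact: (integrableZl measurableT c sf). Qed.

Lemma summable_norm f : summable f -> summable (fun x => `|f x|).
Proof. by move=> sf; exact: (integrable_norm sf). Qed.

Lemma prim_increment f x y : summable f -> x <= y ->
  prim f y - prim f x = (\int[mu]_(t in (`]x, y] : set R)) f t)%R.
Proof.
by move=> sf xy; rewrite /prim Rintegral_itvB ?bnd_simp//; exact: summableS.
Qed.

Lemma prim_increment_oo f x y : summable f -> x <= y ->
  prim f y - prim f x = (\int[mu]_(t in (`]x, y[ : set R)) f t)%R.
Proof.
by move=> sf xy; rewrite prim_increment// Rintegral_itv_bndo_bndc//;
  exact: summableS.
Qed.

Lemma primB f g x : summable f -> summable g ->
  prim (fun t => f t - g t) x = prim f x - prim g x.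
Proof. by move=> sf sg; rewrite /prim RintegralB//; exact: summableS. Qed.

Lemma primZ c f x : summable f -> prim (fun t => c * f t) x = c * prim f x.
Proof. by move=> sf; rewrite /prim RintegralZl//; exact: summableS. Qed.

Lemma prim_increment_le f g x y : summable f -> summable g -> x <= y ->
  (forall t, x < t < y -> f t <= g t) ->
  prim f y - prim f x <= prim g y - prim g x.
Proof.
move=> sf sg xy fg; rewrite !prim_increment_oo//.
by apply: le_Rintegral => //; exact: summableS.
Qed.

Lemma prim_increment_norm f x y : summable f -> x <= y ->
  `|prim f y - prim f x| <= prim (fun t => `|f t|) y - prim (fun t => `|f t|) x.
Proof.
move=> sf xy; rewrite !prim_increment//; last exact: summable_norm.
by apply: le_normr_Rintegral => //; exact: summableS.
Qed.

Lemma prim_increment_ler f c x y : summable f -> x <= y ->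
  (forall t, x < t < y -> f t <= c) -> prim f y - prim f x <= c * (y - x).
Proof.
move=> sf xy fc; rewrite prim_increment_oo//.
have muxy : mu (`]x, y[ : set R) = (y - x)%:E.
  rewrite lebesgue_measure_itv/= lte_fin; case: ltP => // yx.
  by have -> : x = y; [apply/eqP; rewrite eq_le xy yx|rewrite subrr].
have -> : c * (y - x) = (\int[mu]_(t in (`]x, y[ : set R)) cst c t)%R.
  by rewrite Rintegral_cst//= muxy.
apply: le_Rintegral => //; first exact: summableS.
  apply: (@measurable_bounded_integrable _ _ _ mu) => //.
    by rewrite /= muxy ltry.
  by exists `|c|; split; [exact: num_real|move=> m /ltW cm t _].
Qed.

Lemma prim_increment_ger f c x y : summable f -> x <= y ->
  (forall t, x < t < y -> c <= f t) -> c * (y - x) <= prim f y - prim f x.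
Proof.
move=> sf xy fc.
have : prim (fun t => -1 * f t) y - prim (fun t => -1 * f t) x <= - c * (y - x).
  apply: prim_increment_ler => //; first exact: summableZ.
  by move=> t /fc; rewrite mulN1r lerN2.
rewrite !primZ//; lra.
Qed.

Lemma prim_nondecreasing f x y : summable f -> (forall t, 0 <= f t) -> x <= y ->
  prim f x <= prim f y.
Proof.
move=> sf f0 xy; rewrite -subr_ge0 prim_increment//.
by apply: Rintegral_ge0.
Qed.

(** Near [x], [prim f] differs by a constant from the integral started at [x - 1], which is
    continuous on [[x - 1, x + 1]]. *)
Lemma prim_continuous f : summable f -> continuous (prim f).
Proof.
move=> sf x.
have [xl xr] : x - 1 < x /\ x < x + 1 by split; lra.
have /continuous_within_itvP : {within `[x - 1, x + 1],
    continuous (fun z => parameterized_integral mu (x - 1) z f)}.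
  by apply: parameterized_integral_continuous; [lra|exact: summableS].
move=> /(_ ltac:(lra)) [+ _ _] => /(_ x); rewrite in_itv/= xl xr => /(_ isT) cx.
have E y : x - 1 <= y ->
    prim f (x - 1) + parameterized_integral mu (x - 1) y f = prim f y.
  move=> xy; rewrite /parameterized_integral -Rintegral_itv_obnd_cbnd; last first.
    exact: summableS.
  by rewrite -prim_increment//; ring.
have h : prim f (x - 1) + parameterized_integral mu (x - 1) z f @[z --> x]
    --> prim f x.
  by rewrite -(E x); [apply: cvgD; [exact: cvg_cst|exact: cx]|exact: ltW].
apply: cvg_trans h; apply: near_eq_cvg; near=> y; rewrite E//.
apply: ltW; near: y; exact: lt_nbhsr.
Unshelve. all: by end_near. Qed.

(** Lebesgue differentiation; it serves to identify the weak derivative of a multiple of the torsion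
    function. *)
Lemma prim_ae_derivable f : summable f ->
  {ae mu, forall x, derivable (prim f) x 1 /\ derive1 (prim f) x = f x}.
Proof.
move=> sf; apply: FTC1Ny; first by move=> y; exact: summableS.
by apply: open_integrable_locally => //; exact: openT.
Qed.

End Primitive.

(** * C^1 step functions, used as test functions *)

Section StepFunction.
Context {R : realType}.
Implicit Types (t x y z k : R).

(* The positive part of [t] and its primitive. *)
Definition ramp t : R := (t + `|t|) / 2.
Definition ramp2 t : R := (t ^+ 2 + t * `|t|) / 4.

(** Second differences of [ramp2] and [ramp]: [step] is a quadratic spline rising from 0 on [t <= 0]
    to 1 on [t >= 2], and [tent], its derivative, is the hat function on [[0, 2]], of height and
    integral 1. *)
Definition step t : R := ramp2 t - 2 * ramp2 (t - 1) + ramp2 (t - 2).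
Definition tent t : R := ramp t - 2 * ramp (t - 1) + ramp (t - 2).

(** Makes it possible to differentiate [ramp2] also at 0, where the absolute value in it has no
    derivative. *)
Lemma is_derive_remainder2 (f : R -> R) (d x : R) :
  (forall h, `|f (x + h) - f x - d * h| <= h ^+ 2) -> is_derive x 1 f d.
Proof.
move=> rem.
have cv : h^-1 *: (f (h *: (1 : R) + x) - f x) @[h --> 0^'] --> d.
  apply/cvgrPdist_le => e e0; near=> h.
  have h0 : h != 0 by near: h; exact: nbhs_dnbhs_neq.
  have he : `|h| <= e by near: h; apply: dnbhs0_le.
  have := rem h; rewrite /GRing.scale/= mulr1 [h + x]addrC.
  have -> : f (x + h) - f x - d * h = - (h * (d - h^-1 * (f (x + h) - f x))).
    by field.
  rewrite normrN normrM -(real_normK (num_real h)) expr2 ler_pM2l ?normr_gt0//.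
  by move=> /le_trans; apply.
apply: DeriveDef; first by apply/cvg_ex; exists d.
by apply: cvg_lim.
Unshelve. all: by end_near. Qed.

Lemma is_derive_ramp2 t : is_derive t 1 ramp2 (ramp t).
Proof.
apply: is_derive_remainder2 => h; rewrite /ramp2 /ramp.
rewrite ler_norml.
case: (ger0P t) => t0; case: (ger0P (t + h)) => th0; apply/andP; split; nra.
Qed.

Lemma is_derive_shift (f : R -> R) (c d x : R) :
  is_derive (x - c) 1 f d -> is_derive x 1 (fun t => f (t - c)) d.
Proof.
move=> fd; have -> : d = d * 1 by rewrite mulr1.
apply: (@is_derive1_comp _ f (fun t => t - c)).
by apply: is_derive_eq; rewrite subr0.
Qed.

Lemma is_derive_step t : is_derive t 1 step (tent t).
Proof.
have d0 := is_derive_ramp2 t.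
have d1 : is_derive t 1 (fun t => ramp2 (t - 1)) (ramp (t - 1)).
  by apply: is_derive_shift; exact: is_derive_ramp2.
have d2 : is_derive t 1 (fun t => ramp2 (t - 2)) (ramp (t - 2)).
  by apply: is_derive_shift; exact: is_derive_ramp2.
exact: is_derive_eq.
Qed.

Lemma continuous_ramp : continuous ramp.
Proof.
move=> t; apply: cvgMl; apply: cvgD; first exact: cvg_id.
by apply: cvg_norm; exact: cvg_id.
Qed.

Lemma continuous_tent : continuous tent.
Proof.
move=> t.
have c (a : R) : (fun t => ramp (t - a)) u @[u --> t] --> ramp (t - a).
  apply: (@cvg_comp _ _ _ (fun t => t - a) ramp); last exact: continuous_ramp.
  by apply: cvgB; [exact: cvg_id|exact: cvg_cst].
apply: cvgD => //; apply: cvgB; first exact: continuous_ramp.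
by apply: cvgMr.
Qed.

Lemma tent_ge0 t : 0 <= tent t.
Proof.
rewrite /tent /ramp.
by case: (ger0P t) => ?; case: (ger0P (t - 1)) => ?;
  case: (ger0P (t - 2)) => ?; lra.
Qed.

Lemma tent_eq0 t : t <= 0 \/ 2 <= t -> tent t = 0.
Proof.
rewrite /tent /ramp.
by move=> h; case: (ger0P t) => ?; case: (ger0P (t - 1)) => ?;
  case: (ger0P (t - 2)) => ?; lra.
Qed.

Lemma step_le0 t : t <= 0 -> step t = 0.
Proof.
move=> t0; rewrite /step /ramp2.
by rewrite !ler0_norm//; [field|lra..].
Qed.

Lemma step_ge2 t : 2 <= t -> step t = 1.
Proof.
move=> t0; rewrite /step /ramp2.
by rewrite !ger0_norm//; [field|lra..].
Qed.

Lemma step_itv t : 0 <= step t <= 1.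
Proof.
rewrite /step /ramp2; apply/andP.
by case: (ger0P t) => ?; case: (ger0P (t - 1)) => ?;
  case: (ger0P (t - 2)) => ?; split; nra.
Qed.

(** The rise takes place on [[z, z + 2 / k]]. As [k] grows, [tent_at k z] concentrates at [z] with
    constant mass 1. *)
Definition step_at k z t := step (k * (t - z)).
Definition tent_at k z t := k * tent (k * (t - z)).

Lemma is_derive_step_at k z t : is_derive t 1 (step_at k z) (tent_at k z t).
Proof.
rewrite /tent_at mulrC.
have d : is_derive t 1 (fun t => k * (t - z)) k.
  by apply: is_derive_eq; rewrite /GRing.scale/= subr0 mulr1.
by apply: (@is_derive1_comp _ step (fun t => k * (t - z))); exact: is_derive_step.
Qed.

Lemma continuous_tent_at k z : continuous (tent_at k z).
Proof.
move=> t; apply: cvgMr.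
apply: (@cvg_comp _ _ _ (fun t => k * (t - z)) tent); last exact: continuous_tent.
by apply: cvgMr; apply: cvgB; [exact: cvg_id|exact: cvg_cst].
Qed.

Lemma derive1_step_diff k x y :
  derive1 (fun t => step_at k x t - step_at k y t) =
  (fun t => tent_at k x t - tent_at k y t).
Proof.
apply/funext => t; rewrite derive1E.
have d1 := is_derive_step_at k x t; have d2 := is_derive_step_at k y t.
by apply: derive_val.
Qed.

(** A C^1 approximation of the indicator of []x, y]]. Its support lies in [[x, y + 2 / k]], which is
    compact in []0, l[]. *)
Lemma step_diff_test_function (l k x y : R) : 0 < k -> 0 < x -> x <= y ->
  y + 2 / k < l -> test_function l (fun t => step_at k x t - step_at k y t).
Proof.
move=> k0 x0 xy yl.
have supp : closure [set t | step_at k x t - step_at k y t != 0] `<=`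
    (`[x, y + 2 / k] : set R).
  rewrite [X in _ `<=` X](closure_id _).1; last exact: itv_closed.
  apply: closure_subset => t /= h; rewrite in_itv/=; apply/andP; split.
    rewrite leNgt; apply/negP => tx; move/negP: h; apply.
    by rewrite /step_at !step_le0 ?subrr//; nra.
  rewrite leNgt; apply/negP => ty; move/negP: h; apply.
  have : 2 < k * (t - y).
    by rewrite -ltr_pdivrMl// mulrC; lra.
  by move=> h; rewrite /step_at !step_ge2 ?subrr//; nra.
split.
- move=> t.
  have d1 := is_derive_step_at k x t; have d2 := is_derive_step_at k y t.
  exact: ex_derive.
- rewrite derive1_step_diff => t.
  by apply: cvgB; exact: continuous_tent_at.
- apply: subclosed_compact supp; first exact: closed_closure.
  exact: segment_compact.
- by move=> t /supp /=; rewrite !in_itv/= => /andP[? ?]; apply/andP; split; lra.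
Qed.

End StepFunction.

(** * Integrals against tents and steps *)

Section WeakDerivative.
Context {R : realType}.
Local Notation mu := (@lebesgue_measure R).
Local Notation summable f := (mu.-integrable setT (EFin \o f)).
Implicit Types (f g h : R -> R) (l x y z k e : R).

Lemma restrict_itv f l x : 0 < x < l -> (f \_ (`]0, l[ : set R)) x = f x.
Proof. by move=> xl; rewrite patchE mem_set//= in_itv. Qed.

Lemma restrict_itv_out f l x : ~ 0 < x < l -> (f \_ (`]0, l[ : set R)) x = 0.
Proof. by move=> xl; rewrite patchE memNset//= in_itv. Qed.

Lemma bounded_mulr_summable h g (c : R) : measurable_fun setT h ->
  (forall t, `|h t| <= c) -> summable g -> summable (fun t => h t * g t).
Proof.
move=> mh hc sg.
apply: (@integrableMr _ _ _ mu _ measurableT h (EFin \o g) mh _ sg).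
by exists c; split; [exact: num_real|move=> m /ltW cm t _; exact: le_trans (hc t) cm].
Qed.

Lemma Rintegral_itvM f h l :
  (\int[mu]_(t in (`]0, l[ : set R)) (f t * h t))%R =
  (\int[mu]_t (h t * (f \_ (`]0, l[ : set R)) t))%R.
Proof.
rewrite Rintegral_mkcond; apply: eq_Rintegral => t _ /=.
by rewrite !patchE; case: ifPn; rewrite ?mulr0// mulrC.
Qed.

Lemma tent_le1 (t : R) : tent t <= 1.
Proof.
rewrite /tent /ramp.
by case: (ger0P t) => ?; case: (ger0P (t - 1)) => ?;
  case: (ger0P (t - 2)) => ?; lra.
Qed.

Lemma tent_at_ge0 k z (t : R) : 0 < k -> 0 <= tent_at k z t.
Proof. by move=> k0; rewrite mulr_ge0 ?tent_ge0// ltW. Qed.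

Lemma tent_at_norm k z (t : R) : 0 < k -> `|tent_at k z t| <= k.
Proof.
move=> k0; rewrite ger0_norm ?tent_at_ge0// /tent_at.
by rewrite -[leRHS]mulr1 ler_pM2l// tent_le1.
Qed.

Lemma measurable_tent_at k z : measurable_fun setT (@tent_at R k z).
Proof. exact: continuous_measurable_fun (@continuous_tent_at _ _ _). Qed.

Lemma step_at_itv k z (t : R) : 0 <= step_at k z t <= 1.
Proof. exact: step_itv. Qed.

Lemma measurable_step_at k z : measurable_fun setT (@step_at R k z).
Proof.
apply: continuous_measurable_fun => t.
by apply/differentiable_continuous/derivable1_diffP;
  have d := is_derive_step_at k z t; exact: ex_derive.
Qed.

Lemma tent_at_out k z (t : R) : 0 < k -> t <= z \/ z + 2 / k <= t ->
  tent_at k z t = 0.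
Proof.
move=> k0 zt; rewrite /tent_at tent_eq0 ?mulr0//.
case: zt => zt; [left; nra|right].
by rewrite mulrC -ler_pdivrMr//; lra.
Qed.

(** The primitive [step_at k z] is still 0 at the left end and has completed its rise to 1 at the
    right end. *)
Lemma Rintegral_tent_at k z l : 0 < k -> 0 <= z -> z + 2 / k <= l ->
  (\int[mu]_(t in (`]0, l[ : set R)) tent_at k z t)%R = 1.
Proof.
move=> k0 z0 zl.
have k2 : 0 < 2 / k by rewrite divr_gt0.
have l0 : 0 < l by lra.
have itau : mu.-integrable `[0, l] (EFin \o tent_at k z).
  apply: continuous_compact_integrable; first exact: segment_compact.
  exact/continuous_subspaceT/continuous_tent_at.
have cs : continuous (@step_at R k z).
  move=> t; apply/differentiable_continuous/derivable1_diffP.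
  by have d := is_derive_step_at k z t; exact: ex_derive.
rewrite Rintegral_itv_obnd_cbnd; last first.
  by apply: integrableS itau => //; exact: subset_itvW.
rewrite Rintegral_itv_bndo_bndc; last first.
  by apply: integrableS itau => //; exact: subset_itv_co_cc.
rewrite /Rintegral (@continuous_FTC2 _ _ (step_at k z))//.
- rewrite /step_at step_ge2 ?step_le0 /= ?subr0//; first nra.
  by rewrite mulrC -ler_pdivrMr//; lra.
- exact/continuous_subspaceT/continuous_tent_at.
- split; [|exact: cvg_at_right_filter (cs _)|exact: cvg_at_left_filter (cs _)].
  by move=> t _; have d := is_derive_step_at k z t; exact: ex_derive.
- move=> t _; rewrite derive1E.
  by have d := is_derive_step_at k z t; exact: derive_val.
Qed.

(** The integral is an average of [f] over [[z, z + 2 / k]]: the tent is a nonnegative weight of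
    total mass 1 carried by that interval. *)
Lemma Rintegral_mul_tent f l k z e : 0 < k -> 0 < z -> z + 2 / k < l ->
  summable (f \_ (`]0, l[ : set R)) ->
  (forall t, z <= t <= z + 2 / k -> `|f t - f z| <= e) ->
  `|(\int[mu]_(t in (`]0, l[ : set R)) (f t * tent_at k z t))%R - f z| <= e.
Proof.
move=> k0 z0 zl sf fe.
pose F := f \_ (`]0, l[ : set R); pose D : set R := `]0, l[%classic.
have mD : measurable D by exact: measurable_itv.
pose one : R -> R := fun=> 1; pose I1 : R -> R := one \_ D.
have D1 t : I1 t = if 0 < t < l then 1 else 0.
  rewrite /I1; case: ifPn => tl; first by rewrite restrict_itv.
  by rewrite restrict_itv_out//; exact/negP.
have s1 : summable (fun t => tent_at k z t * I1 t).
  apply: (@bounded_mulr_summable _ _ k); first exact: measurable_tent_at.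
    by move=> t; exact: tent_at_norm.
  rewrite (_ : _ \o _ = ((EFin \o one) \_ D))%E; last first.
    by apply/funext => t; rewrite /I1 /= !patchE; case: ifP.
  apply/(integrable_mkcond _ _).1 => //.
  apply: (@measurable_bounded_integrable _ _ _ mu) => //.
    rewrite /D /= lebesgue_measure_itv/=; case: ifP => _ //.
    by rewrite -EFinB ltry.
    exact: measurable_cst.
  by exists (1 : R); split; [exact: num_real|move=> m /ltW cm t _; rewrite /one normr1].
have i1 : (\int[mu]_t (tent_at k z t * I1 t))%R = 1.
  by rewrite -(Rintegral_tent_at k0 (ltW z0) (ltW zl)) -Rintegral_itvM;
    apply: eq_Rintegral => t _; rewrite mul1r.
have sF : summable (fun t => tent_at k z t * F t).
  apply: (@bounded_mulr_summable _ _ k) => //; first exact: measurable_tent_at.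
  by move=> t; exact: tent_at_norm.
rewrite Rintegral_itvM -/F.
have key t : (f z - e) * (tent_at k z t * I1 t) <=
    tent_at k z t * F t <= (f z + e) * (tent_at k z t * I1 t).
  rewrite D1; case: ifPn => tl; last first.
    by rewrite /F restrict_itv_out ?(mulr0, lexx)//; exact/negP.
  rewrite /F restrict_itv// mulr1.
  have [tz|zt] := leP t z; first by rewrite tent_at_out ?mul0r ?(mulr0, lexx)//; left.
  have [tz|tz] := leP (z + 2 / k) t.
    by rewrite tent_at_out ?mul0r ?(mulr0, lexx)//; right.
  have /fe : z <= t <= z + 2 / k by rewrite !ltW.
  rewrite ler_norml => /andP[? ?].
  have t0 := tent_at_ge0 z t k0.
  by apply/andP; split; nra.
rewrite ler_norml; apply/andP; split.
  suff : (f z - e) * 1 <= (\int[mu]_t (tent_at k z t * F t))%R by lra.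
  rewrite -i1 -RintegralZl//; apply: le_Rintegral => //; first exact: summableZ.
  by move=> t _; case/andP: (key t).
suff : (\int[mu]_t (tent_at k z t * F t))%R <= (f z + e) * 1 by lra.
rewrite -i1 -RintegralZl//; apply: le_Rintegral => //; first exact: summableZ.
by move=> t _; case/andP: (key t).
Qed.

Lemma Rintegral_restrict_oc f x y : summable f -> x <= y ->
  (\int[mu]_t ((f \_ (`]x, y] : set R)) t))%R = prim f y - prim f x.
Proof. by move=> sf xy; rewrite -Rintegral_mkcond prim_increment. Qed.

Lemma summable_restrict f (D : set R) : measurable D -> summable f ->
  summable (f \_ D).
Proof.
move=> mD sf; rewrite (_ : _ \o _ = ((EFin \o f) \_ D))%E; last first.
  by apply/funext => t; rewrite /= !patchE; case: ifP.
by apply/(integrable_mkcond _ _).1 => //; exact: summableS.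
Qed.

(** The difference of steps and the indicator of []x, y]] differ only on []x, x + 2 / k]] and []y, y
    + 2 / k]], and by at most 1, so the error is at most the integral of [|G|] over these two
    intervals. *)
Lemma Rintegral_mul_step g l k x y e : 0 < k -> x <= y ->
  summable (g \_ (`]0, l[ : set R)) ->
  let G := g \_ (`]0, l[ : set R) in let Q := prim (fun t => `|G t|) in
  Q (x + 2 / k) - Q x <= e -> Q (y + 2 / k) - Q y <= e ->
  `|(\int[mu]_(t in (`]0, l[ : set R)) (g t * (step_at k x t - step_at k y t)))%R
    - (prim G y - prim G x)| <= e + e.
Proof.
move=> k0 xy sG G Q ex ey; set d := 2 / k in ex ey.
have d0 : 0 < d by rewrite /d divr_gt0.
have phi t : `|step_at k x t - step_at k y t| <= 1.
  have /andP[? ?] := step_at_itv k x t; have /andP[? ?] := step_at_itv k y t.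
  by rewrite ler_norml; apply/andP; split; lra.
have sNG := summable_norm sG.
have sphi : summable (fun t => (step_at k x t - step_at k y t) * G t).
  apply: (@bounded_mulr_summable _ _ 1) => //.
  by apply: measurable_funB; exact: measurable_step_at.
rewrite Rintegral_itvM -/G -Rintegral_restrict_oc//.
have sR := summable_restrict (measurable_itv `]x, y]) sG.
rewrite -RintegralB//.
apply: le_trans (le_normr_Rintegral _ _) _ => //; first exact: summableB.
apply: le_trans (lerD ex ey).
have mx : x <= x + d by rewrite lerDl ltW.
have my : y <= y + d by rewrite lerDl ltW.
rewrite -!Rintegral_restrict_oc// -RintegralD//; last 2 first.
- exact: summable_restrict.
- exact: summable_restrict.
apply: le_Rintegral => //.
- exact/summable_norm/summableB.
- by apply: summableD; exact: summable_restrict.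
move=> t _; rewrite -/G !patchE.
have G0 := normr_ge0 (G t).
have in_oc (a b : R) : (t \in (`]a, b]%classic : set R)) = (a < t <= b).
  by rewrite mem_setE in_itv.
have out z : t <= z -> step_at k z t = 0.
  by move=> tz; rewrite /step_at step_le0//; nra.
have post z : z + d < t -> step_at k z t = 1.
  by move=> tz; rewrite /step_at step_ge2// mulrC -ler_pdivrMr// -/d; lra.
rewrite !in_oc.
have phiG : `|(step_at k x t - step_at k y t) * G t| <= `|G t|.
  by rewrite normrM ler_piMl.
have phiG1 : step_at k y t = 0 ->
    `|(step_at k x t - step_at k y t) * G t - G t| <= `|G t|.
  move=> ->; rewrite subr0 -[in X in _ - X](mul1r (G t)) -mulrBl normrM ler_piMl//.
  have /andP[? ?] := step_at_itv k x t.
  by rewrite ler_norml; apply/andP; split; lra.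
have [tx|xt] := leP t x.
  rewrite /= !out//; last lra.
  by rewrite subrr mul0r subr0 normr0; case: ifP; rewrite ?addr0 ?add0r.
rewrite /=; have [ty|yt] := leP t y.
  rewrite /= addr0; have [txd|txd] := leP t (x + d).
    by apply: phiG1; exact: out.
  by rewrite post// out// subr0 mul1r subrr normr0.
(* Outside its set a restriction takes the default value [point], which is 0 in [R]. *)
rewrite /= subr0 -[point]/(0 : R); have [txd|txd] := leP t (x + d).
  by case: ifP => _; apply: le_trans phiG _; rewrite ?addr0// lerDl.
have [tyd|tyd] := leP t (y + d); first by rewrite add0r.
by rewrite !post// subrr mul0r normr0 addr0.
Qed.

End WeakDerivative.

(** * From weak derivatives to increments; the bisection principle *)

Section Increments.
Context {R : realType}.
Local Notation mu := (@lebesgue_measure R).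
Local Notation summable f := (mu.-integrable setT (EFin \o f)).
Implicit Types (f g h : R -> R) (l x y z e : R).

Lemma continuous_at_right_near f z e : {for z, continuous f} -> 0 < e ->
  \forall d \near (0 : R)^'+, forall t, z <= t <= z + d -> `|f t - f z| <= e.
Proof.
move=> cf e0.
have : \forall t \near z, `|f z - f t| <= e by move/cvgrPdist_le: cf => /(_ e e0).
move=> [r /= r0 hr]; near=> d => t /andP[zt td].
rewrite distrC; apply: hr => /=.
rewrite distrC ger0_norm ?subr_ge0//.
have : d < r by near: d; exact: nbhs_right_lt.
lra.
Unshelve. all: by end_near. Qed.

Lemma within_continuous_cst_itv f x y (c : R) : x < y ->
  {within `[x, y], continuous f} -> (forall t, x < t < y -> f t = c) ->
  forall t, x <= t <= y -> f t = c.
Proof.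
move=> xy /continuous_within_itvP => /(_ xy)[_ fx fy] fc t /andP[].
rewrite le_eqVlt => /predU1P[<- _|xt].
  apply: (@cvg_unique _ (@Rhausdorff R) (f @ x^'+)) => //.
  apply: cvg_near_cst; near=> t'; apply: fc; apply/andP; split.
    by near: t'; exact: nbhs_right_gt.
  by near: t'; exact: nbhs_right_lt.
rewrite le_eqVlt => /predU1P[->|ty]; last by apply: fc; rewrite xt ty.
apply: (@cvg_unique _ (@Rhausdorff R) (f @ y^'-)) => //.
apply: cvg_near_cst; near=> t'; apply: fc; apply/andP; split.
  by near: t'; exact: nbhs_left_gt.
by near: t'; exact: nbhs_left_lt.
Unshelve. all: by end_near. Qed.

(* Bisection: each halving of the interval halves the upper bound. *)
Lemma nonincreasing_increments (Phi M : R -> R) (C : R) x0 y0 : x0 <= y0 ->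
  (forall x y, x0 <= x -> x <= y -> y <= y0 ->
     Phi y - Phi x <= C * (y - x) * (M y - M x)) ->
  Phi y0 <= Phi x0.
Proof.
move=> xy0 hPhi.
have bis n : forall x y, x0 <= x -> x <= y -> y <= y0 ->
    (Phi y - Phi x) * 2 ^+ n <= C * (y - x) * (M y - M x).
  elim: n => [|n IH] x y xx xy yy; first by rewrite expr0 mulr1; exact: hPhi.
  pose m := (x + y) / 2.
  have [xm my] : x <= m /\ m <= y by rewrite /m; split; lra.
  have h1 := IH x m xx xm ltac:(lra).
  have h2 := IH m y ltac:(lra) my yy.
  have mx : m - x = (y - x) / 2 by rewrite /m; field.
  have ym : y - m = (y - x) / 2 by rewrite /m; field.
  rewrite mx in h1; rewrite ym in h2; rewrite exprS.
  have -> : C * (y - x) * (M y - M x) =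
    2 * (C * ((y - x) / 2) * (M m - M x) + C * ((y - x) / 2) * (M y - M m)).
    by field.
  have -> : (Phi y - Phi x) * (2 * 2 ^+ n) =
    2 * ((Phi m - Phi x) * 2 ^+ n + (Phi y - Phi m) * 2 ^+ n) by ring.
  by rewrite ler_pM2l// lerD.
rewrite leNgt; apply/negP => lt.
set a := Phi y0 - Phi x0; have a0 : 0 < a by rewrite /a; lra.
set B := C * (y0 - x0) * (M y0 - M x0).
(* Then [2 ^ n.+1 > n.+1 > |B| / a], so the bound obtained after [n.+1] halvings is violated. *)
pose n := Num.truncn (`|B| / a).
have := bis n.+1 x0 y0 (lexx _) xy0 (lexx _); rewrite -/a -/B.
apply/negP; rewrite -ltNge.
apply: le_lt_trans (ler_norm _) _.
rewrite mulrC -ltr_pdivrMr//.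
apply: (@lt_trans _ _ n.+1%:R).
  by apply: truncnS_gt.
by rewrite -natrX ltr_nat ltn_expl.
Qed.

Lemma constant_increments (Phi M : R -> R) (C : R) x0 y0 : x0 <= y0 ->
  (forall x y, x0 <= x -> x <= y -> y <= y0 ->
     `|Phi y - Phi x| <= C * (y - x) * (M y - M x)) ->
  Phi y0 = Phi x0.
Proof.
move=> xy0 hPhi; apply/eqP; rewrite eq_le; apply/andP; split.
  apply: (@nonincreasing_increments Phi M C) => // x y x0x xy yy0.
  exact: le_trans (ler_norm _) (hPhi x y x0x xy yy0).
rewrite -lerN2.
apply: (@nonincreasing_increments (fun x => - Phi x) M C) => // x y x0x xy yy0.
apply: le_trans (hPhi x y x0x xy yy0).
by rewrite -opprD -normrN ler_norm.
Qed.

(** Tested with a difference of steps, the left side of the weak identity is nearly [f x - f y], a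
    difference of two averages, and the right side is nearly minus the increment of the primitive of
    [g]. *)
Lemma is_weak_derivative_increment_oo l f g x y :
  {within `[0, l], continuous f} ->
  summable (f \_ (`]0, l[ : set R)) -> summable (g \_ (`]0, l[ : set R)) ->
  is_weak_derivative l f g -> 0 < x -> x <= y -> y < l ->
  f y - f x = prim (g \_ (`]0, l[ : set R)) y - prim (g \_ (`]0, l[ : set R)) x.
Proof.
move=> cf sf sg fg x0 xy yl; set G := g \_ _.
apply/eqP; rewrite -subr_eq0 -normr_eq0 eq_le normr_ge0 andbT.
apply/ler_addgt0Pl => e' e'0; rewrite addr0.
(* Four errors of size [e]: the averages of [f] at [x] and at [y], and the two ramps of the step
   difference, of width [d = 2 / k]. *)
pose e := e' / 4; have e0 : 0 < e by rewrite divr_gt0.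
have l0 : 0 < l by lra.
have cfz z : 0 < z -> z < l -> {for z, continuous f}.
  move=> z0 zl; move/continuous_within_itvP : cf => /(_ l0)[+ _ _].
  by move=> /(_ z); rewrite in_itv/= z0 zl; exact.
have cQ z : {for z, continuous (prim (fun t => `|G t|))}.
  exact/prim_continuous/summable_norm.
near (0 : R)^'+ => d.
have d0 : 0 < d by near: d; exact: nbhs_right_gt.
pose k := 2 / d; have k0 : 0 < k by rewrite divr_gt0.
have kd : 2 / k = d by rewrite /k; field; rewrite gt_eqF.
have ydl : y + d < l.
  have : d < l - y by near: d; apply: nbhs_right_lt; rewrite subr_gt0.
  lra.
have fx : forall t, x <= t <= x + d -> `|f t - f x| <= e.
  near: d; apply: continuous_at_right_near => //; apply: cfz => //; lra.
have fy : forall t, y <= t <= y + d -> `|f t - f y| <= e.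
  near: d; apply: continuous_at_right_near => //; apply: cfz => //; lra.
pose Q := prim (fun t => `|G t|).
have Qx : forall t, x <= t <= x + d -> `|Q t - Q x| <= e.
  by near: d; apply: continuous_at_right_near.
have Qy : forall t, y <= t <= y + d -> `|Q t - Q y| <= e.
  by near: d; apply: continuous_at_right_near.
have Ix : `|(\int[mu]_(t in (`]0, l[ : set R)) (f t * tent_at k x t))%R - f x| <= e.
  by apply: Rintegral_mul_tent; rewrite ?kd//; lra.
have Iy : `|(\int[mu]_(t in (`]0, l[ : set R)) (f t * tent_at k y t))%R - f y| <= e.
  by apply: Rintegral_mul_tent; rewrite ?kd//; lra.
have IG := @Rintegral_mul_step _ g l k x y e k0 xy sg.
rewrite /= kd -/G -/Q in IG.
have {}IG := IG (le_trans (ler_norm _) (Qx (x + d) ltac:(lra)))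
                (le_trans (ler_norm _) (Qy (y + d) ltac:(lra))).
have sT z : mu.-integrable (`]0, l[ : set R) (EFin \o (fun t => f t * tent_at k z t)).
  apply/(integrable_mkcond _ _).2 => //.
  have : summable (fun t => tent_at k z t * (f \_ (`]0, l[ : set R)) t).
    apply: (@bounded_mulr_summable _ _ _ k) => //; first exact: measurable_tent_at.
    by move=> t; exact: tent_at_norm.
  congr (integrable _ _ _); apply/funext => t /=; rewrite !patchE.
  by case: ifP; rewrite ?mulr0// mulrC.
have := fg _ (step_diff_test_function k0 x0 xy _); rewrite kd => /(_ ydl).
rewrite derive1_step_diff.
under eq_Rintegral do rewrite mulrBr.
rewrite RintegralB// => E.
move: Ix Iy IG E; rewrite !ler_norml /e => /andP[? ?] /andP[? ?] /andP[? ?] E.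
apply/andP; split; lra.
Unshelve. all: by end_near. Qed.

(** Test functions vanish near the ends, so the end points are reached by continuity: [f - prim G]
    is constant inside and continuous on [[0, l]]. *)
Lemma is_weak_derivative_increment l f g x y :
  {within `[0, l], continuous f} ->
  summable (f \_ (`]0, l[ : set R)) -> summable (g \_ (`]0, l[ : set R)) ->
  is_weak_derivative l f g -> 0 <= x -> x <= y -> y <= l ->
  f y - f x = prim (g \_ (`]0, l[ : set R)) y - prim (g \_ (`]0, l[ : set R)) x.
Proof.
move=> cf sf sg fg x0 xy yl; set G := g \_ _.
have [->|yx] := eqVneq x y; first by rewrite !subrr.
have {xy yx}xy : x < y by rewrite lt_neqAle yx.
have l0 : 0 < l by lra.
pose H t := f t - prim G t.
suff HH t : 0 <= t <= l -> H t = H (l / 2).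
  have := HH x ltac:(lra); have := HH y ltac:(lra); rewrite /H; lra.
apply: within_continuous_cst_itv => //.
  move=> t'; apply: cvgB; first exact: cf.
  by apply: (continuous_subspaceT _); exact: prim_continuous.
move=> {}t /andP[t0 tl].
have [tl2|tl2] := leP t (l / 2).
  have := is_weak_derivative_increment_oo cf sf sg fg t0 tl2 ltac:(lra).
  by rewrite /H -/G; lra.
have := @is_weak_derivative_increment_oo l f g (l / 2) t cf sf sg fg
  ltac:(lra) (ltW tl2) tl.
by rewrite /H -/G; lra.
Qed.

End Increments.

(** * Integration by parts against the weight [a - x] on one edge *)

Section Edge.
Context {R : realType}.
Local Notation mu := (@lebesgue_measure R).
Local Notation summable f := (mu.-integrable setT (EFin \o f)).
Implicit Types (f g h : R -> R) (l x y z e a : R).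
Local Notation cut l f := (f \_ (`]0, l[ : set R)).

Lemma Rintegral_prim f l : summable (cut l f) -> 0 <= l ->
  (\int[mu]_(t in (`]0, l[ : set R)) f t)%R = prim (cut l f) l - prim (cut l f) 0.
Proof.
move=> sf l0; rewrite prim_increment_oo//; apply: eq_Rintegral => t.
by rewrite inE/= in_itv/= => tl; rewrite restrict_itv.
Qed.

Lemma summable_restrictE f (D : set R) : measurable D ->
  summable (f \_ D) <-> mu.-integrable D (EFin \o f).
Proof.
move=> mD; rewrite (_ : EFin \o (f \_ D) = ((EFin \o f) \_ D)%E).
  by apply: iff_sym; exact: integrable_mkcond.
by apply/funext => t; rewrite /= !patchE; case: ifP.
Qed.

Lemma cut_weight_summable a g l : summable (cut l g) ->
  summable (cut l (fun t => (a - t) * g t)).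
Proof.
move=> sg.
have -> : cut l (fun t => (a - t) * g t) =
    (fun t => cut l (fun t => a - t) t * cut l g t).
  by apply/funext => t; rewrite !patchE; case: ifP; rewrite ?mulr0.
apply: (@bounded_mulr_summable _ _ _ (`|a| + `|l|)) => //.
  apply/(measurable_restrictT _ _).1 => //.
  by apply: measurable_funB => //; exact: measurable_id.
move=> t; have [tl|/negP tl] := boolP (0 < t < l).
  rewrite restrict_itv//; move/andP: tl => [t0 tl].
  apply: le_trans (ler_normB _ _) _; rewrite lerD2l gtr0_norm// ltW//.
  exact: lt_le_trans tl (ler_norm _).
by rewrite restrict_itv_out// normr0 addr_ge0.
Qed.

Lemma cut_norm f l : cut l (fun t => `|f t|) = (fun t => `|cut l f t|).
Proof.
by apply/funext => t; rewrite !patchE; case: ifP => // _; rewrite normr0.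
Qed.

Lemma cut_norm_summable f l : summable (cut l f) -> summable (cut l (fun t => `|f t|)).
Proof. by move=> sf; rewrite cut_norm; exact: summable_norm. Qed.

(** Absolute continuity of [f] on [[0, l]] with derivative [g], in integrated form: it depends on
    [g] only up to null sets. *)
Definition has_increments l f g := [/\ summable (cut l f), summable (cut l g) &
  forall x y, 0 <= x -> x <= y -> y <= l ->
    f y - f x = prim (cut l g) y - prim (cut l g) x].

Lemma has_increments_norm l f g : has_increments l f g ->
  forall x y, 0 <= x -> x <= y -> y <= l ->
    `|f y - f x| <= prim (cut l (fun t => `|g t|)) y -
                    prim (cut l (fun t => `|g t|)) x.
Proof.
move=> [sf sg fg] x y x0 xy yl; rewrite fg// cut_norm.
exact: prim_increment_norm.
Qed.

Lemma prim_cut_increment_ler f l c x y : summable (cut l f) ->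
  0 <= x -> x <= y -> y <= l -> (forall t, x < t < y -> f t <= c) ->
  prim (cut l f) y - prim (cut l f) x <= c * (y - x).
Proof.
move=> sf x0 xy yl fc; apply: prim_increment_ler => // t /andP[xt ty].
by rewrite restrict_itv ?fc ?xt//; apply/andP; split; lra.
Qed.

Lemma prim_cut_increment_ger f l c x y : summable (cut l f) ->
  0 <= x -> x <= y -> y <= l -> (forall t, x < t < y -> c <= f t) ->
  c * (y - x) <= prim (cut l f) y - prim (cut l f) x.
Proof.
move=> sf x0 xy yl fc; apply: prim_increment_ger => // t /andP[xt ty].
by rewrite restrict_itv ?fc ?xt//; apply/andP; split; lra.
Qed.

Lemma prim_cut_increment_approx f l c B x y : summable (cut l f) ->
  0 <= x -> x <= y -> y <= l -> (forall t, x < t < y -> `|f t - c| <= B) ->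
  `|prim (cut l f) y - prim (cut l f) x - c * (y - x)| <= B * (y - x).
Proof.
move=> sf x0 xy yl fc.
have h1 : prim (cut l f) y - prim (cut l f) x <= (c + B) * (y - x).
  apply: prim_cut_increment_ler => // t /fc; rewrite ler_norml; lra.
have h2 : (c - B) * (y - x) <= prim (cut l f) y - prim (cut l f) x.
  apply: prim_cut_increment_ger => // t /fc; rewrite ler_norml; lra.
rewrite ler_norml; apply/andP; split; lra.
Qed.

(* [d((a - x) f) = - f dx + (a - x) g dx], up to errors of second order. *)
Lemma parts_constant a l f g : has_increments l f g ->
  forall x y, 0 <= x -> x <= y -> y <= l ->
  prim (cut l f) y + (a - y) * f y - prim (cut l (fun t => (a - t) * g t)) y =
  prim (cut l f) x + (a - x) * f x - prim (cut l (fun t => (a - t) * g t)) x.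
Proof.
move=> fg x0 y0 x00 xy0 y0l.
pose Q := prim (cut l (fun t => `|g t|)).
apply: (@constant_increments _ (fun x => prim (cut l f) x + (a - x) * f x -
  prim (cut l (fun t => (a - t) * g t)) x) Q 2) => // x y x0x xy yy0.
have [sf sg incr] := fg.
have x_ge0 : 0 <= x by lra.
have yl : y <= l by lra.
have nincr := has_increments_norm fg.
have sQ := cut_norm_summable sg.
have Q0 s t : s <= t -> Q s <= Q t.
  by move=> st; apply: prim_nondecreasing => // r; rewrite cut_norm.
(* Since [(a - y) f y - (a - x) f x = - (y - x) f y + (a - x) (f y - f x)], it remains to compare
   each term with the increment of a primitive. In [h2] the weights differ by [x - t], of size at
   most [y - x]. Each error is at most [(y - x) (Q y - Q x)], whence the constant 2. *)
have h1 : `|prim (cut l f) y - prim (cut l f) x - f y * (y - x)| <=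
    (Q y - Q x) * (y - x).
  apply: prim_cut_increment_approx => // t /andP[xt ty].
  rewrite distrC; apply: le_trans (nincr t y _ _ _) _; try lra.
  by rewrite -/Q; have := Q0 x t (ltW xt); lra.
have h2 : `|prim (cut l (fun t => (a - t) * g t)) y -
    prim (cut l (fun t => (a - t) * g t)) x -
    (a - x) * (prim (cut l g) y - prim (cut l g) x)| <= (y - x) * (Q y - Q x).
  have sw := cut_weight_summable a sg.
  have E t : cut l (fun t => (a - t) * g t) t - (a - x) * cut l g t =
      cut l (fun t => (x - t) * g t) t.
    by rewrite !patchE; case: ifP => _; rewrite ?mulr0 ?subr0//; ring.
  have K t : prim (cut l (fun t => (x - t) * g t)) t =
      prim (cut l (fun t => (a - t) * g t)) t - (a - x) * prim (cut l g) t.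
    rewrite -primZ// -primB//; last exact: summableZ.
    by congr (prim _ t); apply/funext => r; rewrite -E.
  rewrite [X in `|X|](_ : _ = prim (cut l (fun t => (x - t) * g t)) y -
    prim (cut l (fun t => (x - t) * g t)) x); last by rewrite !K; ring.
  have sx := cut_weight_summable x sg.
  apply: le_trans (prim_increment_norm sx xy) _.
  rewrite mulrBr -!primZ//.
  apply: prim_increment_le => //; [exact: summable_norm|exact: summableZ|].
  move=> t /andP[xt ty]; rewrite !restrict_itv; [|apply/andP; split; lra..].
  by rewrite normrM ler_wpM2r// ltr0_norm; lra.
have e1 := incr x y x_ge0 xy yl; rewrite -e1 in h2.
move: h1 h2; rewrite !ler_norml => /andP[? ?] /andP[? ?].
apply/andP; split; lra.
Qed.

(** Formally the derivative is [(a - x) |f|' - |a - x| |g|], which is nonpositive because [|f|]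
    varies no faster than [f]. Only this one-sided bound survives the absolute values, hence an
    inequality where [parts_constant] has an equality. *)
Lemma parts_norm_nonincreasing a l f g : has_increments l f g ->
  forall x y, 0 <= x -> x <= y -> y <= l ->
  prim (cut l (fun t => `|f t|)) y + (a - y) * `|f y| -
    prim (cut l (fun t => `|(a - t) * g t|)) y <=
  prim (cut l (fun t => `|f t|)) x + (a - x) * `|f x| -
    prim (cut l (fun t => `|(a - t) * g t|)) x.
Proof.
move=> fg x0 y0 x00 xy0 y0l.
pose Q := prim (cut l (fun t => `|g t|)).
apply: (@nonincreasing_increments _ (fun x => prim (cut l (fun t => `|f t|)) x +
  (a - x) * `|f x| - prim (cut l (fun t => `|(a - t) * g t|)) x) Q 2) =>
  // x y x0x xy yy0.
have [sf sg incr] := fg.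
have x_ge0 : 0 <= x by lra.
have yl : y <= l by lra.
have nincr := has_increments_norm fg.
have sQ := cut_norm_summable sg.
have Q0 s t : s <= t -> Q s <= Q t.
  by move=> st; apply: prim_nondecreasing => // r; rewrite cut_norm.
have h1 : prim (cut l (fun t => `|f t|)) y - prim (cut l (fun t => `|f t|)) x <=
    (`|f y| + (Q y - Q x)) * (y - x).
  apply: prim_cut_increment_ler => //; first exact: cut_norm_summable.
  move=> t /andP[xt ty].
  have := nincr t y ltac:(lra) (ltW ty) yl; rewrite -/Q distrC.
  by have := lerB_dist (f t) (f y); have := Q0 x t (ltW xt); lra.
(* Freezing the weight at [x] costs [(y - x) (Q y - Q x)]; [h1] costs the same, and the remaining
   terms [|a - x| (Q y - Q x)] cancel against [h5]. *)
have h2 : (`|a - x| - (y - x)) * (Q y - Q x) <=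
    prim (cut l (fun t => `|(a - t) * g t|)) y -
    prim (cut l (fun t => `|(a - t) * g t|)) x.
  have sw := cut_norm_summable (cut_weight_summable a sg).
  rewrite mulrBr -!primZ//.
  apply: prim_increment_le => //; first exact: summableZ.
  move=> t /andP[xt ty]; rewrite !restrict_itv; [|apply/andP; split; lra..].
  rewrite normrM ler_wpM2r//.
  have := ler_normB (a - t) (x - t).
  have -> : (a - t) - (x - t) = a - x by ring.
  by rewrite (ltr0_norm (x := x - t)); lra.
have h3 := nincr x y x_ge0 xy yl; rewrite -/Q in h3.
have h4 := le_trans (lerB_dist (f y) (f x)) h3.
have h5 : (a - x) * (`|f y| - `|f x|) <= `|a - x| * (Q y - Q x).
  apply: le_trans (ler_norm _) _; rewrite normrM ler_wpM2l//.
  exact: le_trans (ler_dist_dist _ _) h3.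
lra.
Qed.

Lemma parts_eq a l f g : 0 <= l -> has_increments l f g ->
  (\int[mu]_(t in (`]0, l[ : set R)) f t)%R =
  (\int[mu]_(t in (`]0, l[ : set R)) ((a - t) * g t))%R
    + (a * f 0 + (l - a) * f l).
Proof.
move=> l0 fg; have [sf sg _] := fg.
rewrite !Rintegral_prim//; last exact/cut_weight_summable.
have := parts_constant a fg (lexx _) l0 (lexx _); lra.
Qed.

(* Differentiating, [(a - x) D' = 0]; the point [x = a] needs care. *)
Lemma parts_rigid a l (D M : R -> R) : 0 < l -> summable (cut l D) ->
  {within `[0, l], continuous D} ->
  (forall x y, 0 <= x -> x <= y -> y <= l -> `|D y - D x| <= M y - M x) ->
  (forall x, 0 <= x <= l ->
    prim (cut l D) x + (a - x) * D x = prim (cut l D) 0 + a * D 0) ->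
  forall x, 0 <= x <= l -> D x = D 0.
Proof.
move=> l0 sD cD DM HD.
have M0 s t : 0 <= s -> s <= t -> t <= l -> M s <= M t.
  by move=> s0 st tl; have := DM s t s0 st tl; have := normr_ge0 (D t - D s); lra.
(* At distance at least [d] from [a], the relation [(a - y) (D y - D x) = O((y - x) (M y - M x))]
   can be divided by [a - y], at the price of the constant [d^-1]. *)
have half x0 y0 d : 0 < d -> 0 <= x0 -> x0 <= y0 -> y0 <= l ->
    (forall t, x0 <= t <= y0 -> d <= `|a - t|) -> D y0 = D x0.
  move=> d0 x00 xy0 y0l da.
  apply: (@constant_increments _ D M d^-1) => // x y x0x xy yy0.
  have approx : `|prim (cut l D) y - prim (cut l D) x - D x * (y - x)| <=
      (M y - M x) * (y - x).
    apply: prim_cut_increment_approx => //; [lra..|] => t /andP[xt ty].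
    apply: le_trans (DM x t _ _ _) _; [lra..|].
    by have := M0 t y ltac:(lra) (ltW ty) ltac:(lra); lra.
  have ex := HD x ltac:(lra); have ey := HD y ltac:(lra).
  have E : prim (cut l D) y - prim (cut l D) x - D x * (y - x) =
    - ((a - y) * (D y - D x)) by lra.
  rewrite E normrN normrM in approx.
  rewrite -mulrA -ler_pdivrMl ?invr_gt0// invrK mulrC [(y - x) * _]mulrC.
  apply: le_trans approx; rewrite mulrC ler_wpM2r//.
  by apply: da; lra.
(* No uniform [d] exists up to [a]; constancy is obtained strictly inside and extended by
   continuity. If [a] lies inside the edge, the pieces on its two sides share the value at [a]. *)
have piece x0 y0 : 0 <= x0 -> x0 < y0 -> y0 <= l -> ~ x0 < a < y0 ->
    forall t, x0 <= t <= y0 -> D t = D ((x0 + y0) / 2).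
  move=> x00 xy0 y0l ax; apply: within_continuous_cst_itv => //.
    apply: continuous_subspaceW cD.
    by apply: subset_itv; rewrite bnd_simp.
  have far s t : x0 < s -> s <= t -> t < y0 -> D t = D s.
    move=> xs st ty.
    have [ax0|x0a] := leP a x0.
      apply: (half s t (s - a)); [lra..|] => r /andP[sr rt].
      by rewrite ler0_norm; lra.
    have y0a : y0 <= a by rewrite leNgt; apply/negP => ?; apply: ax; rewrite x0a.
    apply: (half s t (a - t)); [lra..|] => r /andP[sr rt].
    by rewrite ger0_norm; lra.
  move=> t /andP[xt ty]; have [h|h] := leP t ((x0 + y0) / 2).
    by symmetry; apply: far; lra.
  by apply: far; lra.
have [al|/negP al] := boolP (0 < a < l); last first.
  have h := piece 0 l (lexx _) l0 (lexx _) al.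
  by move=> x xl; rewrite h// -(h 0)//; lra.
move/andP: al => [a0 al].
have h1 := piece 0 a (lexx _) a0 (ltW al).
have h2 := piece a l (ltW a0) al (lexx _).
have {}h1 := h1 ltac:(move=> /andP[? ?]; lra).
have {}h2 := h2 ltac:(move=> /andP[? ?]; lra).
move=> x /andP[x0 xl]; have [xa|xa] := leP x a.
  by rewrite h1 ?x0// -(h1 0)//; lra.
by rewrite h2 ?xl ?ltW// -(h2 a) ?lexx ?ltW// (h1 a) ?lexx ?ltW// -(h1 0)//; lra.
Qed.

End Edge.

(** * The map [|t|^(p-2) t] and Young's inequality *)

Section PFlux.
Context {R : realType}.
Implicit Types (p q r s t : R).

Lemma pflux_norm p t : 1 < p -> `|pflux p t| = `|t| `^ (p - 1).
Proof.
move=> p1; rewrite /pflux normrM (ger0_norm (powR_ge0 _ _)) mulrC.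
have -> : p - 2 = p - 1 - 1 by ring.
by rewrite mulr_powRB1// subr_gt0.
Qed.

Lemma pflux_mulr p t : 1 < p -> pflux p t * t = `|t| `^ p.
Proof.
move=> p1; rewrite /pflux -mulrA -expr2 -(real_normK (num_real t)) expr2 mulrA.
rewrite [X in X * _]mulrC; have -> : p - 2 = p - 1 - 1 by ring.
by rewrite mulr_powRB1 ?subr_gt0// mulrC mulr_powRB1//; lra.
Qed.

Lemma pflux0 p : pflux p 0 = 0.
Proof. by rewrite /pflux mulr0. Qed.

Lemma pflux_gt0 p t : (0 < pflux p t) = (0 < t).
Proof.
have [t0|t0|->] := ltgtP t 0; last by rewrite pflux0 ltxx.
- by apply/negbTE; rewrite -leNgt /pflux mulr_ge0_le0 ?powR_ge0// ltW.
- by rewrite /pflux mulr_gt0 ?powR_gt0 ?normr_gt0 ?gt_eqF.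
Qed.

Lemma pfluxN p t : pflux p (- t) = - pflux p t.
Proof. by rewrite /pflux normrN mulrN. Qed.

Lemma pflux_lt0 p t : (pflux p t < 0) = (t < 0).
Proof. by rewrite -oppr_gt0 -pfluxN pflux_gt0 oppr_gt0. Qed.

(** For the conjugate exponent [q = p / (p - 1)] one has [(p - 1) (q - 1) = 1]. Inverting the flux
    gives an explicit formula for [w'], hence its measurability and boundedness. *)
Lemma pflux_conjugate p t : 1 < p -> pflux (p / (p - 1)) (pflux p t) = t.
Proof.
move=> p1; have [->|t0] := eqVneq t 0; first by rewrite !pflux0.
rewrite {1}/pflux pflux_norm// -powRrM {1}/pflux mulrA -powRD; last first.
  by apply/implyP => _; rewrite normr_eq0.
have -> : (p - 1) * (p / (p - 1) - 2) + (p - 2) = 0.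
  by field; rewrite subr_eq0 gt_eqF.
by rewrite powRr0 mul1r.
Qed.

Lemma measurable_pflux p : measurable_fun setT (@pflux R p).
Proof.
apply: measurable_funM => //.
exact: (measurableT_comp (measurable_powR _)).
Qed.

(** At 0 the factor [|t|^(p-2)] may be unbounded, so continuity there comes from
    [|pflux p t| = |t|^(p-1)]; elsewhere both factors are continuous. *)
Lemma continuous_pflux p : 1 < p -> continuous (@pflux R p).
Proof.
move=> p1 t; have [->|t0] := eqVneq t 0.
  apply/cvgrPdist_le => e e0; rewrite pflux0.
  pose d := e `^ (p - 1)^-1; have d0 : 0 < d by rewrite powR_gt0.
  have p10 : 0 < p - 1 by rewrite subr_gt0.
  near=> h; rewrite sub0r normrN pflux_norm//.
  have -> : e = d `^ (p - 1).
    by rewrite /d -powRrM mulVf ?gt_eqF// powRr1// ltW.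
  apply: ge0_ler_powR; [exact: ltW|by rewrite nnegrE|by rewrite nnegrE ltW|].
  by near: h; exact: (@pseudometric_normed_Zmodule.nbhs0_le _ R^o).
have cp : {for `|t|, continuous (fun s => s `^ (p - 2))}.
  apply/differentiable_continuous/derivable1_diffP/derivable_powR.
  by rewrite in_itv/= andbT normr_gt0.
apply: (@cvgM _ _ _ _ (fun t => `|t| `^ (p - 2)) id); last exact: cvg_id.
apply: (@cvg_comp _ _ _ (fun t : R => `|t|) (fun s => s `^ (p - 2)) _ _ _ _ cp).
by apply: cvg_norm; exact: cvg_id.
Unshelve. all: by end_near. Qed.

(** For the Kirchhoff condition: the flux of a one-sided derivative at a vertex becomes a limit of
    fluxes of difference quotients. *)
Lemma pflux_lim (T : Type) (F : set_system T) (FF : ProperFilter F) p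
  (f : T -> R) (a : R) : 1 < p -> cvg (f @ F) -> pflux p (f x) @[x --> F] --> a ->
  pflux p (lim (f @ F)) = a.
Proof.
move=> p1 cf fa.
apply: (@cvg_unique _ (@Rhausdorff R) (pflux p (f x) @[x --> F])) => //.
apply: cvg_comp cf _; exact: continuous_pflux.
Qed.

(* For [s = r e^x], Young's inequality is [e^u >= 1 + u] at [(p - 1) x] and at
   [- x], whence the equality case. *)
Lemma young_powR p r s : 1 < p -> 0 <= r -> 0 <= s ->
  s * r `^ (p - 1) <= s `^ p / p + (1 - p^-1) * r `^ p ?= iff (s == r).
Proof.
move=> p1 r0 s0; have p0 : 0 < p by lra.
have pV : 0 < p^-1 < 1 by rewrite invr_gt0 p0/= invf_lt1.
have p10 : p - 1 != 0 by rewrite subr_eq0 gt_eqF.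
have [->|rn0] := eqVneq r 0.
  rewrite powR0// (powR0 (lt0r_neq0 p0)) !mulr0 addr0; split.
    by rewrite divr_ge0 ?powR_ge0// ltW.
  rewrite eq_sym mulf_eq0 invr_eq0 (gt_eqF p0) orbF powR_eq0.
  by rewrite (gt_eqF p0) andbT.
have r_gt0 : 0 < r by rewrite lt_neqAle eq_sym rn0.
have [->|sn0] := eqVneq s 0.
  have h : 0 < (1 - p^-1) * r `^ p by rewrite mulr_gt0 ?powR_gt0//; lra.
  rewrite (powR0 (lt0r_neq0 p0)) !mul0r add0r; split; first exact: ltW.
  by rewrite lt_eqF// lt_eqF.
have s_gt0 : 0 < s by rewrite lt_neqAle eq_sym sn0.
pose x := ln s - ln r.
have Es : s = expR (ln r + x) by rewrite /x addrC subrK lnK.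
have sr : (s == r) = (x == 0).
  by rewrite /x subr_eq0; apply/eqP/eqP => [->//|/ln_inj]; apply; rewrite posrE.
set a := ln r in x Es sr *.
have H1 : s * r `^ (p - 1) = expR (p * a) * expR x.
  rewrite /powR (negbTE rn0) -/a Es -!expRD; congr expR; ring.
have H2 : s `^ p = expR (p * a) * expR x * expR ((p - 1) * x).
  by rewrite /powR (negbTE sn0) Es expRK -!expRD; congr expR; ring.
have H3 : r `^ p = expR (p * a) * expR x * expR (- x).
  by rewrite /powR (negbTE rn0) -/a -!expRD; congr expR; ring.
rewrite H1 H2 H3 sr.
set K := expR (p * a) * expR x; have K0 : 0 < K by rewrite mulr_gt0 ?expR_gt0.
have -> : K * expR ((p - 1) * x) / p + (1 - p^-1) * (K * expR (- x)) =
  K * (expR ((p - 1) * x) * p^-1 + (1 - p^-1) * expR (- x)) by ring.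
rewrite -{1}[K]mulr1.
have [->|x0] := eqVneq x 0.
  have -> : expR ((p - 1) * 0) * p^-1 + (1 - p^-1) * expR (- 0) = 1 :> R.
    by rewrite mulr0 oppr0 expR0; ring.
  by split; rewrite ?eqxx.
have lt1 : 1 < expR ((p - 1) * x) * p^-1 + (1 - p^-1) * expR (- x).
  have h1 : 1 + (p - 1) * x < expR ((p - 1) * x) by rewrite expR_gt1Dx// mulf_neq0.
  have h2 : 1 - x < expR (- x) by rewrite expR_gt1Dx// oppr_eq0.
  have h3 : (1 + (p - 1) * x) * p^-1 < expR ((p - 1) * x) * p^-1.
    by rewrite ltr_pM2r//; lra.
  have h4 : (1 - p^-1) * (1 - x) < (1 - p^-1) * expR (- x).
    by rewrite ltr_pM2l//; lra.
  (* The weights [1 / p] and [1 - 1 / p] are those for which the linear terms of the two tangents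
     cancel. *)
  have h5 : (1 + (p - 1) * x) * p^-1 + (1 - p^-1) * (1 - x) = 1.
    by field; rewrite gt_eqF.
  lra.
split; first by rewrite ler_pM2l// ltW.
by rewrite (inj_eq (mulfI (lt0r_neq0 K0))) lt_eqF.
Qed.

End PFlux.

(** * [L^p] functions and representatives of the weak derivative *)

Section LpItv.
Context {R : realType}.
Local Notation mu := (@lebesgue_measure R).
Local Notation summable f := (mu.-integrable setT (EFin \o f)).
Local Notation cut l f := (f \_ (`]0, l[ : set R)).
Implicit Types (f g h : R -> R) (l x p : R).

Lemma Lp_itv_measurable p l f : Lp_itv p l f -> measurable_fun setT (cut l f).
Proof. by rewrite /Lp_itv inE => /andP[/[!inE]]. Qed.

Lemma cut_powR p l f : p != 0 ->
  cut l (fun t => `|f t| `^ p) = (fun t => `|cut l f t| `^ p).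
Proof.
move=> p0; apply/funext => t; rewrite !patchE; case: ifP => // _.
by rewrite normr0 powR0.
Qed.

Lemma Lp_itv_powR_summable p l f : 1 <= p -> Lp_itv p l f ->
  summable (cut l (fun t => `|f t| `^ p)).
Proof.
move=> p1 fp; rewrite cut_powR; last by rewrite gt_eqF//; lra.
exact: Lfun_integrable fp.
Qed.

Lemma itv_cst_summable l (c : R) : summable (cut l (fun=> c)).
Proof.
apply/summable_restrictE => //.
apply: (@measurable_bounded_integrable _ _ _ mu) => //.
  rewrite /= lebesgue_measure_itv/=; case: ifP => _ //.
  by rewrite -EFinB ltry.
by exists `|c|; split; [exact: num_real|move=> m /ltW cm t _].
Qed.

(** On a bounded interval [|f| <= 1 + |f|^p] is an integrable bound. *)
Lemma Lp_itv_summable p l f : 1 <= p -> Lp_itv p l f -> summable (cut l f).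
Proof.
move=> p1 fp; have sp := Lp_itv_powR_summable p1 fp.
have s1 := summableD (itv_cst_summable l 1) sp.
apply: (le_integrable measurableT _ _ s1).
  by apply/measurable_EFinP; exact: Lp_itv_measurable fp.
move=> t _ /=; rewrite lee_fin !patchE; case: ifP => _; last first.
  by rewrite normr0 addr0 normr0.
rewrite [leRHS]ger0_norm ?addr_ge0 ?powR_ge0//.
have [f1|f1] := leP `|f t| 1; first by rewrite (le_trans f1)// lerDl powR_ge0.
by rewrite (le_trans (le1r_powR (ltW f1) p1))// lerDr.
Qed.

(** Near an interior point [f] equals the primitive of [g] up to a constant, and almost everywhere
    that primitive has derivative [g]. *)
Lemma weak_derivative_ae l f g : 0 < l -> {within `[0, l], continuous f} ->
  summable (cut l f) -> summable (cut l g) -> is_weak_derivative l f g ->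
  {ae mu, forall x, 0 < x < l -> g x = derive1 f x}.
Proof.
move=> l0 cf sf sg fg.
apply: (@filterS _ _ (ae_filter_ringOfSetsType mu) _ _ _ (prim_ae_derivable sg)) => x [dG G'] xl.
move/andP: (xl) => [x0 xl'].
rewrite -(restrict_itv g xl) -G' !derive1E.
have -> : 'D_1 f x = 'D_1 (fun y => prim (cut l g) y + (f x - prim (cut l g) x)) x.
  apply: near_eq_derive; near=> y.
  have y0 : 0 < y by near: y; exact: lt_nbhsr.
  have yl : y < l by near: y; exact: lt_nbhsl.
  have [xy|yx] := leP x y.
    have := is_weak_derivative_increment cf sf sg fg (ltW x0) xy (ltW yl); lra.
  have := is_weak_derivative_increment cf sf sg fg (ltW y0) (ltW yx) (ltW xl').
  lra.
by rewrite deriveD// derive_cst addr0.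
Unshelve. all: by end_near. Qed.

Lemma weak_derivativeP p l f : sobolev_itv p l f ->
  Lp_itv p l (weak_derivative p l f) /\
  is_weak_derivative l f (weak_derivative p l f).
Proof. by move=> [_ [g gf]]; rewrite /weak_derivative; case: xgetP => [? _|/(_ g)]. Qed.

Lemma sobolev_has_increments p l f : 1 <= p -> sobolev_itv p l f ->
  {within `[0, l], continuous f} -> has_increments l f (weak_derivative p l f).
Proof.
move=> p1 sf cf; have [gp fg] := weak_derivativeP sf.
have s1 := Lp_itv_summable p1 (proj1 sf); have s2 := Lp_itv_summable p1 gp.
by split=> // x y x0 xy yl; exact: is_weak_derivative_increment.
Qed.

Lemma ae_eq_prim f g l : measurable_fun setT (cut l f) ->
  measurable_fun setT (cut l g) ->
  {ae mu, forall x, 0 < x < l -> f x = g x} ->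
  prim (cut l f) = prim (cut l g).
Proof.
move=> mf mg fg; apply/funext => x; rewrite /prim /Rintegral; congr fine.
apply: ae_eq_integral => //.
- by apply/measurable_EFinP; exact: measurable_funS mf.
- by apply/measurable_EFinP; exact: measurable_funS mg.
apply: (@filterS _ _ (ae_filter_ringOfSetsType mu) _ _ _ fg) => t fgt _.
rewrite !patchE; case: ifPn => //.
by rewrite inE/= in_itv/= => /fgt ->.
Qed.

Lemma ae_eq_Rintegral_itv f g l :
  measurable_fun setT (cut l f) -> measurable_fun setT (cut l g) ->
  {ae mu, forall x, 0 < x < l -> f x = g x} ->
  (\int[mu]_(t in (`]0, l[ : set R)) f t)%R =
  (\int[mu]_(t in (`]0, l[ : set R)) g t)%R.
Proof.
move=> mf mg fg; rewrite /Rintegral; congr fine.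
apply: ae_eq_integral => //.
- by apply/measurable_EFinP/(measurable_restrictT _ _).2.
- by apply/measurable_EFinP/(measurable_restrictT _ _).2.
apply: (@filterS _ _ (ae_filter_ringOfSetsType mu) _ _ _ fg) => t fgt.
by rewrite /= in_itv/= => /fgt ->.
Qed.

End LpItv.

(** * The torsion function on one edge *)

Section TorsionEdge.
Context {R : realType}.
Local Notation mu := (@lebesgue_measure R).
Local Notation summable f := (mu.-integrable setT (EFin \o f)).
Local Notation cut l f := (f \_ (`]0, l[ : set R)).
Variables (p l a : R) (w : R -> R).
Hypotheses (p_gt1 : 1 < p) (l_gt0 : 0 < l).
Hypothesis w_cont : {within `[0, l], continuous w}.
Hypothesis w_derivable : forall x, 0 < x < l -> derivable w x 1.
Let v := derive1 w.

Lemma MVT_itv x y : 0 <= x -> x < y -> y <= l ->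
  exists c, [/\ x < c, c < y & w y - w x = v c * (y - x)].
Proof.
move=> x0 xy yl.
have dw t : t \in `]x, y[ -> is_derive t 1 w (v t).
  rewrite in_itv/= => /andP[xt ty]; rewrite /v derive1E; apply: derivableP.
  by apply: w_derivable; apply/andP; split; lra.
have cw : {within `[x, y], continuous w}.
  by apply: continuous_subspaceW w_cont; apply: subset_itv; rewrite bnd_simp.
have [c] := MVT xy dw cw; rewrite in_itv/= => /andP[xc cy] E.
by exists c.
Qed.

Section Flux.
Hypothesis flux : forall x, 0 < x < l -> pflux p (v x) = a - x.

(** By the mean value theorem the quotient is [v c] with [0 < c < h], and its flux [a - c] tends to
    [a]. *)
Lemma torsion_src_flux : cvg ((w h - w 0) / h @[h --> 0^'+]) ->
  pflux p (lim ((w h - w 0) / h @[h --> 0^'+])) = a.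
Proof.
move=> cw; apply: pflux_lim => //.
apply/cvgrPdist_le => e e0; near=> h.
have h0 : 0 < h by near: h; exact: nbhs_right_gt.
have hl : h < l by near: h; exact: nbhs_right_lt.
have he : h < e by near: h; exact: nbhs_right_lt.
have [c [c0 ch]] := MVT_itv (lexx _) h0 (ltW hl).
rewrite subr0 => ->; rewrite mulfK ?gt_eqF// flux; last by apply/andP; split; lra.
by rewrite ger0_norm; lra.
Unshelve. all: by end_near. Qed.

(** At this end the direction into the edge is reversed: the quotient is [- v c], with flux [c - a]
    and [c] tending to [l]. *)
Lemma torsion_tgt_flux : cvg ((w (l - h) - w l) / h @[h --> 0^'+]) ->
  pflux p (lim ((w (l - h) - w l) / h @[h --> 0^'+])) = l - a.
Proof.
move=> cw; apply: pflux_lim => //.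
apply/cvgrPdist_le => e e0; near=> h.
have h0 : 0 < h by near: h; exact: nbhs_right_gt.
have hl : h < l by near: h; exact: nbhs_right_lt.
have he : h < e by near: h; exact: nbhs_right_lt.
have [c [c0 ch E]] := MVT_itv (x := l - h) (y := l) ltac:(lra) ltac:(lra) (lexx _).
have -> : (w (l - h) - w l) / h = - v c.
  rewrite -[w (l - h) - w l]opprB E opprB addrC subrK.
  by rewrite mulNr mulfK ?gt_eqF.
rewrite pfluxN flux; last by apply/andP; split; lra.
by rewrite ger0_norm; lra.
Unshelve. all: by end_near. Qed.

Lemma torsion_increasing x y : 0 <= x -> x < y -> y <= l -> y <= a -> w x < w y.
Proof.
move=> x0 xy yl ya; have [c [xc cy E]] := MVT_itv x0 xy yl.
rewrite -subr_gt0 E mulr_gt0 ?subr_gt0// -(pflux_gt0 p) flux ?subr_gt0; lra.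
Qed.

Lemma torsion_decreasing x y : 0 <= x -> x < y -> y <= l -> a <= x -> w y < w x.
Proof.
move=> x0 xy yl ya; have [c [xc cy E]] := MVT_itv x0 xy yl.
rewrite -subr_lt0 E pmulr_llt0 ?subr_gt0// -(pflux_lt0 p) flux ?subr_lt0; lra.
Qed.

(** [w] increases strictly before [a] and decreases strictly after it, so an interior value exceeds
    the value at one of the ends. *)
Lemma torsion_interior_gt0 : (forall x, 0 <= x <= l -> 0 <= w x) ->
  forall x, 0 < x < l -> 0 < w x.
Proof.
move=> w0 x /andP[x0 xl].
have [ax|xa] := leP a x.
  by apply: le_lt_trans (torsion_decreasing (ltW x0) xl _ ax) => //; apply: w0; lra.
by apply: le_lt_trans (torsion_increasing _ x0 (ltW xl) (ltW xa)) => //; apply: w0; lra.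
Qed.

(** Hopf's boundary lemma on an edge: with [a <= 0], [w] would decrease strictly from 0 to
    [w l >= 0]. *)
Lemma torsion_src_zero : 0 <= w l -> w 0 = 0 -> 0 < a.
Proof.
move=> wl w0; rewrite ltNge; apply/negP => a0.
by have := torsion_decreasing (lexx _) l_gt0 (lexx _) a0; lra.
Qed.

Lemma torsion_tgt_zero : 0 <= w 0 -> w l = 0 -> 0 < l - a.
Proof.
move=> wl w0; rewrite ltNge; apply/negP => a0.
by have := torsion_increasing (lexx _) l_gt0 (lexx _) ltac:(lra); lra.
Qed.

Lemma torsion_derive1E x : 0 < x < l -> v x = pflux (p / (p - 1)) (a - x).
Proof. by move=> xl; rewrite -flux// pflux_conjugate. Qed.

Lemma measurable_torsion_derive1 : measurable_fun setT (cut l v).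
Proof.
have -> : cut l v = cut l (fun x => pflux (p / (p - 1)) (a - x)).
  apply/funext => x; rewrite !patchE; case: ifPn => //.
  by rewrite inE/= in_itv/= => /torsion_derive1E.
apply/(measurable_restrictT _ _).1 => //.
apply: (@measurable_funS _ _ _ _ setT) => //.
apply: (measurableT_comp (measurable_pflux _)).
by apply: measurable_funB.
Qed.

Lemma summable_torsion_derive1 : summable (cut l v).
Proof.
have p10 : 0 < p - 1 by rewrite subr_gt0.
have q1 : 1 < p / (p - 1) by rewrite ltr_pdivlMr// mul1r gtrBl.
apply/summable_restrictE => //.
apply: (@measurable_bounded_integrable _ _ _ mu) => //.
- by rewrite /= lebesgue_measure_itv/=; case: ifP => _ //; rewrite -EFinB ltry.
- by apply/(measurable_restrictT _ _).2 => //; exact: measurable_torsion_derive1.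
(* Here [|v t| = |a - t|^(q - 1)] with [q = p / (p - 1)], and [|a - t| <= |a| + l]. *)
exists ((`|a| + l) `^ (p / (p - 1) - 1)); split; first exact: num_real.
move=> m /ltW cm t /=; rewrite in_itv/= => tl; apply: le_trans cm.
rewrite torsion_derive1E// pflux_norm//; apply: ge0_ler_powR.
- by rewrite subr_ge0 ltW.
- by rewrite nnegrE.
- by rewrite nnegrE addr_ge0// ltW.
apply: le_trans (ler_normB _ _) _; rewrite lerD2l.
by move/andP: tl => [? ?]; rewrite ger0_norm; lra.
Qed.

Lemma torsion_derive1_powR x : 0 < x < l -> `|v x| `^ p = (a - x) * v x.
Proof. by move=> xl; rewrite -pflux_mulr// flux. Qed.

Lemma summable_torsion_powR (c : R) : summable (cut l (fun x => c * `|v x| `^ p)).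
Proof.
have -> : cut l (fun x => c * `|v x| `^ p) =
    (fun x => c * cut l (fun x => (a - x) * v x) x).
  apply/funext => x; rewrite !patchE; case: ifPn => [|_]; last by rewrite mulr0.
  by rewrite inE/= in_itv/= => xl; rewrite torsion_derive1_powR.
exact/summableZ/cut_weight_summable/summable_torsion_derive1.
Qed.

Lemma torsion_weak_derivative_ae (c : R) (f : R -> R) : f = (fun x => c * w x) ->
  sobolev_itv p l f -> {within `[0, l], continuous f} ->
  {ae mu, forall x, 0 < x < l -> weak_derivative p l f x = c * v x}.
Proof.
move=> fw sf cf; have [gp fg] := weak_derivativeP sf.
have s1 := Lp_itv_summable (ltW p_gt1) (proj1 sf).
have s2 := Lp_itv_summable (ltW p_gt1) gp.
apply: (@filterS _ _ (ae_filter_ringOfSetsType mu) _ _ _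
  (weak_derivative_ae l_gt0 cf s1 s2 fg)) => x gx xl.
by rewrite gx// fw derive1Ml//; exact: w_derivable.
Qed.

(** The chosen weak derivative and [v] agree almost everywhere, so they have the same primitive. *)
Lemma torsion_has_increments : sobolev_itv p l w -> has_increments l w v.
Proof.
move=> sw; have [s1 s2 incr] := sobolev_has_increments (ltW p_gt1) sw w_cont.
split=> //; first exact: summable_torsion_derive1.
move=> x y x0 xy yl; rewrite incr//.
suff -> : prim (cut l (weak_derivative p l w)) = prim (cut l v) by [].
apply: ae_eq_prim; [|exact: measurable_torsion_derive1|].
  exact: Lp_itv_measurable (proj1 (weak_derivativeP sw)).
have w1 : w = (fun x => 1 * w x) by apply/funext => t; rewrite mul1r.
have := torsion_weak_derivative_ae w1 sw w_cont.
apply: (@filterS _ _ (ae_filter_ringOfSetsType mu)) => t h tl.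
by rewrite h// mul1r.
Qed.

(** [weak_derivative] makes a separate choice for each function, so homogeneity is read off from
    [c * v], with which the choice agrees almost everywhere. *)
Lemma torsion_energy_scale (c : R) (f : R -> R) : f = (fun x => c * w x) ->
  sobolev_itv p l f -> {within `[0, l], continuous f} ->
  (\int[mu]_(x in (`]0, l[ : set R)) (`|weak_derivative p l f x| `^ p))%R =
  `|c| `^ p * (\int[mu]_(x in (`]0, l[ : set R)) (`|v x| `^ p))%R.
Proof.
move=> fw sf cf; rewrite -RintegralZl//; last first.
  apply/summable_restrictE => //.
  rewrite (_ : (fun x => `|v x| `^ p) = (fun x => 1 * `|v x| `^ p)).
    exact: summable_torsion_powR.
  by apply/funext => t; rewrite mul1r.
have s := Lp_itv_powR_summable (ltW p_gt1) (proj1 (weak_derivativeP sf)).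
apply: ae_eq_Rintegral_itv.
- by have /measurable_int/measurable_EFinP := s.
- by have /measurable_int/measurable_EFinP := summable_torsion_powR (`|c| `^ p).
apply: (@filterS _ _ (ae_filter_ringOfSetsType mu) _ _ _
  (torsion_weak_derivative_ae fw sf cf)) => x gx xl.
by rewrite gx// normrM powRM.
Qed.

End Flux.

Lemma torsion_flux_affine :
  (forall x, 0 < x < l -> is_derive x 1 (fun y => pflux p (v y)) (-1)) ->
  exists b, forall x, 0 < x < l -> pflux p (v x) = b - x.
Proof.
move=> dv; exists (pflux p (v (l / 2)) + l / 2).
have incr x y : 0 < x -> x <= y -> y < l -> pflux p (v y) - pflux p (v x) = x - y.
  move=> x0 xy yl.
  have [||c _ ->] := @MVT_segment _ (fun y => pflux p (v y)) (fun=> -1) x y xy.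
  - move=> t; rewrite in_itv/= => /andP[xt ty]; apply: dv.
    by apply/andP; split; lra.
  - apply: continuous_in_subspaceT => t; rewrite inE/= in_itv/= => /andP[xt ty].
    apply/differentiable_continuous/derivable1_diffP.
    by have [] := dv t ltac:(lra).
  - by rewrite mulN1r opprB.
move=> x /andP[x0 xl]; have [h|h] := leP x (l / 2).
  by have := incr x (l / 2) x0 h ltac:(lra); lra.
by have := incr (l / 2) x ltac:(lra) (ltW h) xl; lra.
Qed.

End TorsionEdge.

(** * The inequality on one edge and its equality case *)

Section EdgeInequality.
Context {R : realType}.
Local Notation mu := (@lebesgue_measure R).
Local Notation summable f := (mu.-integrable setT (EFin \o f)).
Local Notation cut l f := (f \_ (`]0, l[ : set R)).

Lemma Rintegral_itv_eq0 (l : R) (f : R -> R) : summable (cut l f) ->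
  (forall x, 0 < x < l -> 0 <= f x) ->
  (\int[mu]_(x in (`]0, l[ : set R)) f x)%R = 0 ->
  {ae mu, forall x, 0 < x < l -> f x = 0}.
Proof.
move=> /summable_restrictE sf f0 If.
have {}sf := sf (measurable_itv _).
pose D : set R := `]0, l[%classic.
have mD : measurable D by exact: measurable_itv.
have mf : measurable_fun D (EFin \o f) by exact: measurable_int sf.
have : (\int[mu]_(x in D) `|(EFin \o f) x|)%E = 0%E.
  have -> : (\int[mu]_(x in D) `|(EFin \o f) x|)%E =
      (\int[mu]_(x in D) (f x)%:E)%E.
    apply: eq_integral => x; rewrite inE /D/= in_itv/= => xl.
    by rewrite ger0_norm// f0.
  rewrite -[LHS]fineK; last exact: integrable_fin_num.
  by move: If; rewrite /Rintegral => ->.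
move=> /(ae_eq_integral_abs mu mD mf).
apply: (@filterS _ _ (ae_filter_ringOfSetsType mu)) => x fx xl.
have : (f x)%:E = 0%E by apply: fx; rewrite /D/= in_itv.
by case.
Qed.

Lemma cut_summableZ (l c : R) (f : R -> R) : summable (cut l f) ->
  summable (cut l (fun x => c * f x)).
Proof.
move=> sf; have -> : cut l (fun x => c * f x) = (fun x => c * cut l f x).
  by apply/funext => x; rewrite !patchE; case: ifP => // _; rewrite mulr0.
exact: summableZ.
Qed.

Lemma cut_summableD (l : R) (f g : R -> R) : summable (cut l f) ->
  summable (cut l g) -> summable (cut l (fun x => f x + g x)).
Proof.
move=> sf sg.
have -> : cut l (fun x => f x + g x) = (fun x => cut l f x + cut l g x).
  by apply/funext => x; rewrite !patchE; case: ifP => // _; rewrite addr0.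
exact: summableD.
Qed.

Lemma cut_summableB (l : R) (f g : R -> R) : summable (cut l f) ->
  summable (cut l g) -> summable (cut l (fun x => f x - g x)).
Proof.
move=> sf sg.
have -> : cut l (fun x => f x - g x) = (fun x => cut l f x - cut l g x).
  by apply/funext => x; rewrite !patchE; case: ifP => // _; rewrite subr0.
exact: summableB.
Qed.

Lemma Rintegral_itvZ (l c : R) (f : R -> R) : summable (cut l f) ->
  (\int[mu]_(x in (`]0, l[ : set R)) (c * f x))%R =
  c * (\int[mu]_(x in (`]0, l[ : set R)) f x)%R.
Proof. by move=> sf; apply: RintegralZl => //; exact/summable_restrictE. Qed.

Lemma Rintegral_itvD (l : R) (f g : R -> R) :
  summable (cut l f) -> summable (cut l g) ->
  (\int[mu]_(x in (`]0, l[ : set R)) (f x + g x))%R =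
  (\int[mu]_(x in (`]0, l[ : set R)) f x)%R +
  (\int[mu]_(x in (`]0, l[ : set R)) g x)%R.
Proof. by move=> sf sg; apply: RintegralD => //; exact/summable_restrictE. Qed.

Lemma Rintegral_itvB (l : R) (f g : R -> R) :
  summable (cut l f) -> summable (cut l g) ->
  (\int[mu]_(x in (`]0, l[ : set R)) (f x - g x))%R =
  (\int[mu]_(x in (`]0, l[ : set R)) f x)%R -
  (\int[mu]_(x in (`]0, l[ : set R)) g x)%R.
Proof. by move=> sf sg; apply: RintegralB => //; exact/summable_restrictE. Qed.

Variables (p l a : R) (w v f g : R -> R) (lam : R).
Hypotheses (p_gt1 : 1 < p) (l_gt0 : 0 < l) (lam_ge0 : 0 <= lam).
Hypothesis flux : forall x, 0 < x < l -> pflux p (v x) = a - x.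
Hypothesis v_powR : summable (cut l (fun x => `|v x| `^ p)).
Hypothesis w_incr : has_increments l w v.
Hypothesis f_incr : has_increments l f g.
Hypothesis g_powR : summable (cut l (fun x => `|g x| `^ p)).

Lemma weight_mul x : 0 < x < l -> (a - x) * v x = `|v x| `^ p.
Proof. by move=> xl; rewrite -pflux_mulr// flux. Qed.

Lemma weight_norm x : 0 < x < l -> `|a - x| = `|v x| `^ (p - 1).
Proof. by move=> xl; rewrite -flux// pflux_norm. Qed.

Lemma torsion_edge_integral :
  (\int[mu]_(x in (`]0, l[ : set R)) w x)%R =
  (\int[mu]_(x in (`]0, l[ : set R)) (`|v x| `^ p))%R + (a * w 0 + (l - a) * w l).
Proof.
rewrite (parts_eq a (ltW l_gt0) w_incr); congr (_ + _).
by apply: eq_Rintegral => x; rewrite inE/= in_itv/= => /weight_mul.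
Qed.

(** The slack in Young's inequality for [s = lam |g|] and [r = |v|], with [|v|^(p-1)] written as
    [|a - x|]. *)
Definition young_gap x :=
  lam `^ p / p * `|g x| `^ p + (1 - p^-1) * `|v x| `^ p - lam * `|(a - x) * g x|.

Lemma young_edge x : 0 < x < l -> 0 <= young_gap x /\
  (young_gap x = 0 -> lam * `|g x| = `|v x|).
Proof.
move=> xl; rewrite /young_gap normrM weight_norm//.
have := young_powR p_gt1 (normr_ge0 (v x)) (mulr_ge0 lam_ge0 (normr_ge0 (g x))).
set s := lam * `|g x|; set r := `|v x| => -[le eq].
have -> : lam `^ p / p * `|g x| `^ p + (1 - p^-1) * r `^ p -
    lam * (r `^ (p - 1) * `|g x|) =
    s `^ p / p + (1 - p^-1) * r `^ p - s * r `^ (p - 1).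
  by rewrite /s powRM//; ring.
split; first by rewrite subr_ge0.
move/eqP; rewrite subr_eq0 eq_sym => h; apply/eqP; by rewrite -eq.
Qed.

Lemma young_gap_summable : summable (cut l young_gap).
Proof.
have [sf sg _] := f_incr.
apply: cut_summableB; last exact/cut_summableZ/cut_norm_summable/cut_weight_summable.
by apply: cut_summableD; exact: cut_summableZ.
Qed.

(** The quantity of [parts_norm_nonincreasing]; its drop along the edge is the loss in the
    integration by parts for [|f|]. *)
Definition norm_parts x := prim (cut l (fun t => `|f t|)) x + (a - x) * `|f x| -
  prim (cut l (fun t => `|(a - t) * g t|)) x.

Lemma Rintegral_young_gap :
  (\int[mu]_(x in (`]0, l[ : set R)) young_gap x)%R =
  lam `^ p / p * (\int[mu]_(x in (`]0, l[ : set R)) (`|g x| `^ p))%R +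
  (1 - p^-1) * (\int[mu]_(x in (`]0, l[ : set R)) (`|v x| `^ p))%R -
  lam * (\int[mu]_(x in (`]0, l[ : set R)) `|(a - x) * g x|)%R.
Proof.
have [sf sg _] := f_incr.
have scut := cut_norm_summable (cut_weight_summable a sg).
rewrite /young_gap Rintegral_itvB//; last 2 first.
- by apply: cut_summableD; exact: cut_summableZ.
- exact: cut_summableZ.
rewrite Rintegral_itvD; [|exact: cut_summableZ..].
by rewrite !Rintegral_itvZ.
Qed.

(** Splits the slack of the edge inequality into two nonnegative losses, from Young's inequality and
    from integration by parts. Equality forces both to vanish. *)
Lemma edge_deficit :
  lam `^ p / p * (\int[mu]_(x in (`]0, l[ : set R)) (`|g x| `^ p))%R +
  (1 - p^-1) * (\int[mu]_(x in (`]0, l[ : set R)) (`|v x| `^ p))%R +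
  lam * (a * `|f 0| + (l - a) * `|f l|) -
  lam * (\int[mu]_(x in (`]0, l[ : set R)) `|f x|)%R =
  (\int[mu]_(x in (`]0, l[ : set R)) young_gap x)%R +
  lam * (norm_parts 0 - norm_parts l).
Proof.
have [sf sg _] := f_incr; have l0 := ltW l_gt0.
rewrite Rintegral_young_gap (Rintegral_prim (f := fun x => `|f x|))//; last first.
  exact: cut_norm_summable.
rewrite (Rintegral_prim (f := fun x => `|(a - x) * g x|))//; last first.
  exact/cut_norm_summable/cut_weight_summable.
by rewrite /norm_parts; ring.
Qed.

Lemma Rintegral_young_gap_ge0 :
  0 <= (\int[mu]_(x in (`]0, l[ : set R)) young_gap x)%R.
Proof.
apply: Rintegral_ge0 => x /=; rewrite in_itv/= => /young_edge[//].
Qed.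

Lemma norm_parts_le x y : 0 <= x -> x <= y -> y <= l ->
  norm_parts y <= norm_parts x.
Proof. exact: parts_norm_nonincreasing. Qed.

Lemma edge_inequality :
  lam * (\int[mu]_(x in (`]0, l[ : set R)) `|f x|)%R <=
  lam `^ p / p * (\int[mu]_(x in (`]0, l[ : set R)) (`|g x| `^ p))%R +
  (1 - p^-1) * (\int[mu]_(x in (`]0, l[ : set R)) (`|v x| `^ p))%R +
  lam * (a * `|f 0| + (l - a) * `|f l|).
Proof.
rewrite -subr_ge0 edge_deficit addr_ge0 ?Rintegral_young_gap_ge0//.
by rewrite mulr_ge0// subr_ge0 norm_parts_le// ltW.
Qed.

Lemma edge_rigidity : {within `[0, l], continuous f} ->
  {within `[0, l], continuous w} ->
  lam * (\int[mu]_(x in (`]0, l[ : set R)) `|f x|)%R =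
  lam `^ p / p * (\int[mu]_(x in (`]0, l[ : set R)) (`|g x| `^ p))%R +
  (1 - p^-1) * (\int[mu]_(x in (`]0, l[ : set R)) (`|v x| `^ p))%R +
  lam * (a * `|f 0| + (l - a) * `|f l|) ->
  forall x, 0 <= x <= l -> lam * `|f x| - w x = lam * `|f 0| - w 0.
Proof.
move=> cf cw E.
have [sf sg fincr] := f_incr; have [sw sv wincr] := w_incr.
have l0 := ltW l_gt0.
have gap0 := Rintegral_young_gap_ge0.
have np x : 0 <= x <= l -> norm_parts l <= norm_parts x <= norm_parts 0.
  by move=> /andP[? ?]; rewrite !norm_parts_le.
have npl : 0 <= lam * (norm_parts 0 - norm_parts l).
  by rewrite mulr_ge0// subr_ge0 norm_parts_le.
have := edge_deficit; rewrite E subrr => /esym def.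
have /andP[/eqP gapE /eqP npE] :
    ((\int[mu]_(x in (`]0, l[ : set R)) young_gap x)%R == 0) &&
    (lam * (norm_parts 0 - norm_parts l) == 0) by rewrite -paddr_eq0// def.
have ae_gv := Rintegral_itv_eq0 young_gap_summable
  (fun x xl => (young_edge xl).1) gapE.
clear E def gap0 npl gapE.
(* [norm_parts] is monotone and, after multiplication by [lam], takes equal values at both ends. *)
have npx x : 0 <= x <= l -> lam * norm_parts x = lam * norm_parts 0.
  move=> /np /andP[h1 h2]; apply/eqP; rewrite eq_le ler_wpM2l//=.
  by have := ler_wpM2l lam_ge0 h1; lra.
have scut := cut_norm_summable (cut_weight_summable a sg).
(* Almost everywhere [lam |g| = |v|], hence [lam |(a - t) g| = |v|^(p-1) |v| = (a - t) v]. *)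
have ep : (fun x => lam * prim (cut l (fun t => `|(a - t) * g t|)) x) =
    prim (cut l (fun t => (a - t) * v t)).
  apply/funext => x; rewrite -primZ//.
  have -> : (fun t => lam * cut l (fun t => `|(a - t) * g t|) t) =
      cut l (fun t => lam * `|(a - t) * g t|).
    by apply/funext => t; rewrite !patchE; case: ifP => // _; rewrite mulr0.
  congr (_ x); apply: ae_eq_prim.
  - have -> : cut l (fun t => lam * `|(a - t) * g t|) =
        (fun t => lam * cut l (fun t => `|(a - t) * g t|) t).
      by apply/funext => t; rewrite !patchE; case: ifP => // _; rewrite mulr0.
    by have /measurable_int/measurable_EFinP := summableZ lam scut.
  - by have /measurable_int/measurable_EFinP := cut_weight_summable a sv.
  apply: (@filterS _ _ (ae_filter_ringOfSetsType mu) _ _ _ ae_gv) => t gap tl.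
  have /(young_edge tl).2 gv := gap tl.
  rewrite normrM mulrCA gv weight_norm// weight_mul// mulrC mulr_powRB1//.
  exact: lt_trans ltr01 p_gt1.
pose D x := lam * `|f x| - w x.
pose M x := lam * prim (cut l (fun t => `|g t|)) x + prim (cut l (fun t => `|v t|)) x.
have cutD : cut l D = (fun x => lam * cut l (fun t => `|f t|) x - cut l w x).
  apply/funext => x; rewrite !patchE; case: ifP => // _.
  by rewrite mulr0 subr0.
have sf' := cut_norm_summable sf.
have sD : summable (cut l D).
  by rewrite cutD; apply: summableB => //; exact: summableZ.
apply: (@parts_rigid _ a l D M l_gt0 sD).
- move=> x; apply: cvgB; last exact: cw.
  by apply: cvgMr; apply: cvg_norm; exact: cf.
- move=> x y x0 xy yl.
  have h1 := has_increments_norm f_incr x0 xy yl.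
  have h2 := has_increments_norm w_incr x0 xy yl.
  have h3 := ler_wpM2l lam_ge0 (le_trans (ler_dist_dist (f y) (f x)) h1).
  have -> : D y - D x = lam * (`|f y| - `|f x|) - (w y - w x) by rewrite /D; ring.
  apply: le_trans (ler_normB _ _) _.
  rewrite normrM (ger0_norm lam_ge0) /M; lra.
(* Subtracting the identity [parts_constant] for [w] from the constancy of [lam * norm_parts]
   cancels the weighted primitives, by [ep]. *)
- move=> x xl; rewrite cutD !primB//; [|exact: summableZ..].
  rewrite !primZ// /D.
  have /andP[x0 xl'] := xl.
  have h1 := npx x xl; rewrite /norm_parts in h1.
  have h2 := parts_constant a w_incr (lexx _) x0 xl'.
  have h3 : lam * prim (cut l (fun t => `|(a - t) * g t|)) x =
    prim (cut l (fun t => (a - t) * v t)) x by rewrite -ep.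
  have h4 : lam * prim (cut l (fun t => `|(a - t) * g t|)) 0 =
    prim (cut l (fun t => (a - t) * v t)) 0 by rewrite -ep.
  lra.
Qed.

End EdgeInequality.

(** * Summation over the graph *)

Section Graph.
Context {R : realType} (G : metric_graph R).
Local Notation mu := (@lebesgue_measure R).
Local Notation summable f := (mu.-integrable setT (EFin \o f)).
Local Notation cut l f := (f \_ (`]0, l[ : set R)).
Implicit Types (u : graph_point G -> R) (e : edge G).

Lemma restr_src u e : restr u e 0 = u (Vertex (src e)).
Proof. by rewrite /restr /edge_pt insubN ?ltxx// lexx. Qed.

Lemma restr_tgt u e : restr u e (len e) = u (Vertex (tgt e)).
Proof.
rewrite /restr /edge_pt insubN ?ltxx ?andbF//.
by rewrite leNgt len_gt0.
Qed.

Lemma restr_interior u e (y : {x : R | 0 < x < len e}) :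
  restr u e (val y) = u (Interior y).
Proof. by rewrite /restr /edge_pt valK. Qed.

Lemma integral_graph_le (f g : edge G -> R -> R) :
  (forall e, summable (cut (len e) (f e))) ->
  (forall e, summable (cut (len e) (g e))) ->
  (forall e x, f e x <= g e x) -> integral_graph f <= integral_graph g.
Proof.
move=> sf sg fg; apply: ler_sum => e _.
by apply: le_Rintegral => //; exact/summable_restrictE.
Qed.

Variables (VD : {set vertex G}) (p : R) (w : graph_point G -> R).
Hypotheses (G_connected : connected_graph G) (p_gt1 : 1 < p).
Hypothesis VD_nonempty : exists v, v \in VD.
Hypothesis w_torsion : is_torsion_function VD p w.

Let w_cont e : {within `[0, len e], continuous (restr w e)}.
Proof. by have [[sw _] _ _ _] := w_torsion; exact: (sw e).2. Qed.

Let w_sobolev e : sobolev_itv p (len e) (restr w e).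
Proof. by have [[sw _] _ _ _] := w_torsion; exact: (sw e).1. Qed.

Let w_derivable e x : 0 < x < len e -> derivable (restr w e) x 1.
Proof. by have [_ dw _ _] := w_torsion => /dw[]. Qed.

Let v e := derive1 (restr w e).

Lemma torsion_flux_exists :
  exists a : edge G -> R, forall e x, 0 < x < len e -> pflux p (v e x) = a e - x.
Proof.
suff /choice[a aP] : forall e, exists b, forall x, 0 < x < len e ->
    pflux p (v e x) = b - x by exists a.
move=> e; apply: torsion_flux_affine.
by have [_ dw _ _] := w_torsion => x /dw[].
Qed.

Variable a : edge G -> R.
Hypothesis flux : forall e x, 0 < x < len e -> pflux p (v e x) = a e - x.

Lemma vertex_flux_sum x : x \notin VD ->
  \sum_(e : edge G | src e == x) a e +
  \sum_(e : edge G | tgt e == x) (len e - a e) = 0.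
Proof.
have [_ _ cw kw] := w_torsion; move=> /kw; rewrite /kirchhoff => kx.
rewrite -[RHS]kx; congr (_ + _).
  apply: eq_bigr => e _; symmetry.
  exact: (torsion_src_flux p_gt1 (len_gt0 e) (w_cont (e := e))
    (w_derivable (e := e)) (flux (e := e)) (cw e).1).
apply: eq_bigr => e _; symmetry.
exact: (torsion_tgt_flux p_gt1 (len_gt0 e) (w_cont (e := e))
  (w_derivable (e := e)) (flux (e := e)) (cw e).2).
Qed.

(** Grouped by vertices, [h x] is multiplied by the total flux out of [x], which is zero by
    Kirchhoff off [VD], while [h] vanishes on [VD]. A loop enters both sums at its vertex. *)
Lemma boundary_sum (h : vertex G -> R) : (forall x, x \in VD -> h x = 0) ->
  \sum_(e : edge G) (a e * h (src e) + (len e - a e) * h (tgt e)) = 0.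
Proof.
move=> hVD; rewrite big_split/=.
rewrite (partition_big (fun e => src e) xpredT)//=.
rewrite [X in _ + X](partition_big (fun e => tgt e) xpredT)//=.
rewrite -big_split/=; apply: big1 => x _.
rewrite (eq_bigr (fun e => a e * h x)); last by move=> e /eqP ->.
rewrite [X in _ + X](eq_bigr (fun e => (len e - a e) * h x)); last first.
  by move=> e /eqP ->.
rewrite -!mulr_suml -mulrDl; have [xVD|xVD] := boolP (x \in VD).
  by rewrite hVD// mulr0.
by rewrite vertex_flux_sum// mul0r.
Qed.

Let incr e : has_increments (len e) (restr w e) (v e).
Proof.
apply: (torsion_has_increments p_gt1 (len_gt0 e)) => //.
- exact: w_derivable.
- exact: flux.
Qed.

Let v_powR e : summable (cut (len e) (fun x => `|v e x| `^ p)).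
Proof.
have := summable_torsion_powR p_gt1 (len_gt0 e) (flux (e := e)) 1.
rewrite (_ : (fun x => 1 * _) = (fun x => `|v e x| `^ p))//.
by apply/funext => x; rewrite mul1r.
Qed.

(** The torsion equation tested with [w] itself. *)
Lemma torsion_integral :
  integral_graph (restr w) = integral_graph (fun e x => `|v e x| `^ p).
Proof.
rewrite /integral_graph.
under eq_bigr => e _.
  rewrite (torsion_edge_integral p_gt1 (len_gt0 e) (flux (e := e)) (incr e)).
  rewrite restr_src restr_tgt; over.
rewrite big_split/= (boundary_sum (h := fun x => w (Vertex x))) ?addr0//.
by have [[_ wVD] _ _ _] := w_torsion.
Qed.

Lemma energy_scale (c : R) u : sobolev p u -> (forall x, u x = c * w x) ->
  energy p u = `|c| `^ p * integral_graph (restr w).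
Proof.
move=> su uw; rewrite torsion_integral /energy /integral_graph mulr_sumr.
apply: eq_bigr => e _.
apply: (torsion_energy_scale p_gt1 (len_gt0 e) (w_derivable (e := e))
  (flux (e := e))); [|exact: (su e).1|exact: (su e).2].
by apply/funext => x; exact: uw.
Qed.

Section Inequality.
Variables (u : graph_point G -> R) (lam : R).
Hypotheses (u_dirichlet : sobolev_dirichlet VD p u) (lam_ge0 : 0 <= lam).

Let u_incr e :
  has_increments (len e) (restr u e) (weak_derivative p (len e) (restr u e)).
Proof.
have [su _] := u_dirichlet.
by apply: sobolev_has_increments; [exact: ltW|exact: (su e).1|exact: (su e).2].
Qed.

Let u_powR e : summable (cut (len e)
  (fun x => `|weak_derivative p (len e) (restr u e) x| `^ p)).
Proof.
have [su _] := u_dirichlet.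
by apply: Lp_itv_powR_summable; [exact: ltW|exact: (weak_derivativeP (su e).1).1].
Qed.

Let lhs e := lam * (\int[mu]_(x in (`]0, len e[ : set R)) `|restr u e x|)%R.
Let rhs e := lam `^ p / p * (\int[mu]_(x in (`]0, len e[ : set R))
    (`|weak_derivative p (len e) (restr u e) x| `^ p))%R +
  (1 - p^-1) * (\int[mu]_(x in (`]0, len e[ : set R)) (`|v e x| `^ p))%R +
  lam * (a e * `|restr u e 0| + (len e - a e) * `|restr u e (len e)|).

Let lhs_le e : lhs e <= rhs e.
Proof.
exact: (edge_inequality p_gt1 (len_gt0 e) lam_ge0 (flux (e := e)) (v_powR e)
  (u_incr e) (u_powR e)).
Qed.

Let lhs_sum : \sum_e lhs e = lam * integral_graph (fun e x => `|restr u e x|).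
Proof. by rewrite mulr_sumr. Qed.

Let rhs_sum : \sum_e rhs e =
  lam `^ p / p * energy p u + (1 - p^-1) * integral_graph (restr w).
Proof.
rewrite torsion_integral !big_split/= -!mulr_sumr -/(integral_graph _).
under [X in _ + lam * X]eq_bigr do rewrite restr_src restr_tgt.
rewrite (boundary_sum (h := fun x => `|u (Vertex x)|)) ?mulr0 ?addr0//.
by move=> x xVD; rewrite u_dirichlet.2// normr0.
Qed.

Lemma graph_inequality : lam * integral_graph (fun e x => `|restr u e x|) <=
  lam `^ p / p * energy p u + (1 - p^-1) * integral_graph (restr w).
Proof. by rewrite -lhs_sum -rhs_sum; apply: ler_sum => e _; exact: lhs_le. Qed.

(** Equality of the sums forces equality on every edge, so [lam |u| - w] is constant along each
    edge; by connectedness it has everywhere the value 0 that it takes at a Dirichlet vertex. *)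
Lemma graph_rigidity : lam * integral_graph (fun e x => `|restr u e x|) =
  lam `^ p / p * energy p u + (1 - p^-1) * integral_graph (restr w) ->
  forall x, lam * `|u x| = w x.
Proof.
rewrite -lhs_sum -rhs_sum => /eqP; rewrite eq_sym -subr_eq0 -sumrB => /eqP E.
have eqe e : lhs e = rhs e.
  apply/eqP; rewrite eq_sym -subr_eq0; apply/eqP.
  by apply: (psumr_eq0P _ E) => // e' _; rewrite subr_ge0 lhs_le.
have [su uVD] := u_dirichlet.
have rig e x : 0 <= x <= len e ->
    lam * `|restr u e x| - restr w e x = lam * `|restr u e 0| - restr w e 0.
  apply: (edge_rigidity p_gt1 (len_gt0 e) lam_ge0 (flux (e := e)) (v_powR e)
    (incr e) (u_incr e) (u_powR e) (su e).2 (w_cont (e := e)) (eqe e)).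
pose d x := lam * `|u (Vertex x)| - w (Vertex x).
have dadj e : d (tgt e) = d (src e).
  have le : 0 <= len e <= len e by rewrite lexx ltW ?len_gt0.
  by have := rig e (len e) le; rewrite !restr_tgt !restr_src.
have [x0 x0VD] := VD_nonempty.
have d0 x : d x = 0.
  have cl : fingraph.closed (@Defs.adjacent R G) [pred x | d x == 0].
    move=> x1 x2 /existsP[e] /orP[]/andP[/eqP <- /eqP <-];
      by rewrite !inE dadj.
  have := closed_connect cl (G_connected x0 x); rewrite !inE.
  have -> : d x0 == 0.
    have [[_ wVD] _ _ _] := w_torsion.
    by rewrite /d uVD// wVD// normr0 mulr0 subrr.
  by move=> /esym/eqP.
case=> [x|e y]; first by have := d0 x; rewrite /d; lra.
have yl : 0 <= val y <= len e by have /andP[? ?] := valP y; apply/andP; split; exact: ltW.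
have := rig e (val y) yl; rewrite !restr_interior !restr_src.
by have := d0 (src e); rewrite /d; lra.
Qed.

End Inequality.

End Graph.

(** * Positivity of the torsion function and the extremals *)

Section Extremals.
Context {R : realType} (G : metric_graph R).
Local Notation mu := (@lebesgue_measure R).
Local Notation summable f := (mu.-integrable setT (EFin \o f)).
Local Notation cut l f := (f \_ (`]0, l[ : set R)).
Implicit Types (u : graph_point G -> R) (e : edge G).
Variables (VD : {set vertex G}) (p : R) (w : graph_point G -> R).
Hypotheses (G_connected : connected_graph G) (p_gt1 : 1 < p).
Hypothesis VD_nonempty : exists v, v \in VD.
Hypothesis VD_degree1 : forall v, v \in VD -> degree v = 1%N.
Hypothesis w_torsion : is_torsion_function VD p w.
Variable a : edge G -> R.
Hypothesis flux : forall e x, 0 < x < len e ->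
  pflux p (derive1 (restr w e) x) = a e - x.

Let p_gt0 : 0 < p. Proof. exact: lt_trans ltr01 p_gt1. Qed.
Let w_dirichlet : sobolev_dirichlet VD p w. Proof. by have [] := w_torsion. Qed.
Let w_cont e : {within `[0, len e], continuous (restr w e)}.
Proof. exact: (w_dirichlet.1 e).2. Qed.
Let w_derivable e x : 0 < x < len e -> derivable (restr w e) x 1.
Proof. by have [_ dw _ _] := w_torsion => /dw[]. Qed.

Definition absint u := integral_graph (fun e x => `|restr u e x|).

Let inequality u (lam : R) :=
  graph_inequality p_gt1 w_torsion flux (u := u) (lam := lam).
Let rigidity u (lam : R) :=
  graph_rigidity G_connected p_gt1 VD_nonempty w_torsion flux (u := u) (lam := lam).

Lemma restr_cut_summable u e : sobolev p u -> summable (cut (len e) (restr u e)).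
Proof. by move=> su; apply: Lp_itv_summable (ltW p_gt1) (proj1 (su e).1). Qed.

Lemma energy_torsion : energy p w = integral_graph (restr w).
Proof.
rewrite (energy_scale p_gt1 w_torsion flux (c := 1) (u := w)).
- by rewrite normr1 powR1 mul1r.
- exact: w_dirichlet.1.
- by move=> x; rewrite mul1r.
Qed.

Lemma integral_le_absint : integral_graph (restr w) <= absint w.
Proof.
apply: integral_graph_le => [e|e|e x]; last exact: ler_norm.
  exact: restr_cut_summable w_dirichlet.1.
by apply: cut_norm_summable; exact: restr_cut_summable w_dirichlet.1.
Qed.

(** The sign of [w] is not yet known. For [u = w] and [lam = 1] the coefficients [1 / p] and
    [1 - 1 / p] add up to 1, and the inequality reads [int |w| <= int w]. *)
Lemma absint_torsion : absint w = integral_graph (restr w).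
Proof.
apply/eqP; rewrite eq_le integral_le_absint andbT.
have := inequality w_dirichlet ler01.
rewrite mul1r powR1 energy_torsion; congr (_ <= _); field.
by rewrite gt_eqF.
Qed.

Lemma torsion_ge0 x : 0 <= w x.
Proof.
have <- : 1 * `|w x| = w x.
  apply: (rigidity w_dirichlet ler01).
  rewrite mul1r powR1 energy_torsion -/(absint w) absint_torsion; field.
  by rewrite gt_eqF.
by rewrite mul1r.
Qed.

Lemma restr_torsion_gt0 e x : 0 < x < len e -> 0 < restr w e x.
Proof.
apply: (torsion_interior_gt0 (w_cont (e := e)) (w_derivable (e := e)) (flux (e := e))).
by move=> t _; exact: torsion_ge0.
Qed.

(** A Dirichlet vertex has degree one; any other vertex is joined to one by a path, whose first edge
    is incident with it. *)
Lemma incident_edge x : exists e, (src e == x) || (tgt e == x).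
Proof.
have [x0 x0VD] := VD_nonempty.
have [->|xx0] := eqVneq x x0.
  have := VD_degree1 x0VD; rewrite /degree => d.
  have : (0 < #|[set e : edge G | src e == x0]%SET| +
              #|[set e : edge G | tgt e == x0]%SET|)%N by rewrite d.
  rewrite addn_gt0 => /orP[] /card_gt0P[e]; rewrite inE => h; exists e;
    by rewrite h ?orbT.
have /connectP[[|y s] /=] := G_connected x x0.
  by move=> _ x0x; rewrite x0x eqxx in xx0.
move=> /andP[/existsP[e /orP[]/andP[h1 h2]] _] _; exists e; first by rewrite h1.
by rewrite h2 orbT.
Qed.

Lemma integral_torsion_gt0 : 0 < integral_graph (restr w).
Proof.
rewrite lt_neqAle eq_sym; apply/andP; split; last first.
  rewrite -absint_torsion; apply: sumr_ge0 => e _.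
  by apply: Rintegral_ge0.
apply/eqP => I0; have [x0 _] := VD_nonempty; have [e _] := incident_edge x0.
have lh : 0 < len e / 2 < len e by have := len_gt0 e; lra.
have := restr_torsion_gt0 lh; suff -> : restr w e (len e / 2) = 0 by rewrite ltxx.
(* If [int w = 0], equality holds at [lam = 0], and rigidity gives [0 * |w x| = w x]. *)
rewrite /restr -(rigidity w_dirichlet (lexx 0)) ?mul0r// I0 powR0 ?gt_eqF//.
by rewrite !mul0r mulr0 addr0.
Qed.

Let I := integral_graph (restr w).
Let I0 : 0 < I. Proof. exact: integral_torsion_gt0. Qed.

Lemma absint_ge0 u : 0 <= absint u.
Proof. by apply: sumr_ge0 => e _; apply: Rintegral_ge0. Qed.

Lemma energy_ge0 u : 0 <= energy p u.
Proof.
by apply: sumr_ge0 => e _; apply: Rintegral_ge0 => x _; exact: powR_ge0.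
Qed.

Lemma quotient_le u : sobolev_dirichlet VD p u ->
  torsion_quotient p u <= I `^ (p - 1) /\
  (torsion_quotient p u = I `^ (p - 1) ->
   exists2 lam, 0 < lam & forall x, lam * `|u x| = w x).
Proof.
move=> du; rewrite /torsion_quotient -/(absint u).
have := energy_ge0 u; rewrite le_eqVlt => /predU1P[<-|E0].
  (* For zero energy the quotient is 0 by the convention [0^-1 = 0], and so differs from
     [I^(p-1) > 0]. *)
  rewrite invr0 mulr0; split; first exact: powR_ge0.
  by move=> /esym/eqP; rewrite gt_eqF// powR_gt0.
set E := energy p u in E0 *; set A := absint u.
(* This scaling makes the two terms on the right of [graph_inequality]
   proportional to [p^-1] and [1 - p^-1], with sum [I]. *)
pose lam := (I / E) `^ p^-1.
have lam0 : 0 < lam by apply: powR_gt0; exact: divr_gt0.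
have lamp : lam `^ p = I / E.
  by rewrite /lam -powRrM mulVf ?gt_eqF// powRr1// divr_ge0// ltW.
have rhsE : lam `^ p / p * E + (1 - p^-1) * I = I.
  by rewrite lamp; field; rewrite !gt_eqF.
have le : lam * A <= I by rewrite -[leRHS]rhsE; exact: inequality du (ltW lam0).
have A0 : 0 <= A by exact: absint_ge0.
have lA0 : 0 <= lam * A by rewrite mulr_ge0// ltW.
have q : A `^ p / E = (lam * A) `^ p / I.
  by rewrite (powRM _ (ltW lam0) A0) lamp; field; rewrite !gt_eqF.
have Ip : I `^ (p - 1) = I `^ p / I.
  by rewrite -(mulr_powRB1 (ltW I0) p_gt0) mulrC mulKf ?gt_eqF.
rewrite q Ip; split.
  rewrite ler_pM2r ?invr_gt0//; apply: ge0_ler_powR => //; first exact: ltW.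
  by rewrite nnegrE ltW.
move=> /(mulIf (invr_neq0 (lt0r_neq0 I0))) /(powR_injective p_gt0) eqA.
exists lam => //; apply: (rigidity du (ltW lam0)).
by rewrite -/(absint u) -/A -/E -/I rhsE; apply: eqA; rewrite nnegrE// ltW.
Qed.

Lemma quotient_scale u (c : R) : sobolev_dirichlet VD p u -> c != 0 ->
  (forall x, u x = c * w x) -> torsion_quotient p u = I `^ (p - 1).
Proof.
move=> du c0 uw; rewrite /torsion_quotient.
rewrite (energy_scale p_gt1 w_torsion flux du.1 uw) -/I.
have -> : integral_graph (fun e x => `|restr u e x|) = `|c| * I.
  rewrite /I -absint_torsion /absint /integral_graph mulr_sumr.
  apply: eq_bigr => e _; rewrite -Rintegral_itvZ; last first.
    by apply: cut_norm_summable; exact: restr_cut_summable w_dirichlet.1.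
  by apply: eq_Rintegral => x _; rewrite /restr uw normrM.
have cp : `|c| `^ p != 0 by rewrite powR_eq0 normr_eq0 (negbTE c0).
rewrite (powRM _ (normr_ge0 c) (ltW I0)) -(mulr_powRB1 (ltW I0) p_gt0).
by field; rewrite cp gt_eqF.
Qed.

(** A strong maximum principle: at a zero of [w] off [VD] the flux into every incident edge would be
    positive, while these fluxes sum to 0 and at least one edge is incident. *)
Lemma torsion_vertex_gt0 x : x \notin VD -> 0 < w (Vertex x).
Proof.
move=> xVD; rewrite lt_neqAle eq_sym torsion_ge0 andbT; apply/eqP => wx.
have src_gt0 e : src e == x -> 0 < a e.
  move=> /eqP ex; apply: (torsion_src_zero (len_gt0 e) (w_cont (e := e))
    (w_derivable (e := e)) (flux (e := e))); first exact: torsion_ge0.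
  by rewrite restr_src ex.
have tgt_gt0 e : tgt e == x -> 0 < len e - a e.
  move=> /eqP ex; apply: (torsion_tgt_zero (len_gt0 e) (w_cont (e := e))
    (w_derivable (e := e)) (flux (e := e))); first exact: torsion_ge0.
  by rewrite restr_tgt ex.
have s1 : 0 <= \sum_(e : edge G | src e == x) a e.
  by apply: sumr_ge0 => e /src_gt0/ltW.
have s2 : 0 <= \sum_(e : edge G | tgt e == x) (len e - a e).
  by apply: sumr_ge0 => e /tgt_gt0/ltW.
have := vertex_flux_sum p_gt1 w_torsion flux xVD => /eqP.
rewrite paddr_eq0// => /andP[/eqP z1 /eqP z2].
have [e /orP[h|h]] := incident_edge x.
  have := src_gt0 e h; rewrite (psumr_eq0P _ z1) ?ltxx//.
  by move=> e' /src_gt0/ltW.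
have := tgt_gt0 e h; rewrite (psumr_eq0P _ z2) ?ltxx//.
by move=> e' /tgt_gt0/ltW.
Qed.

Section Sign.
Variables (u : graph_point G -> R) (lam : R).
Hypotheses (u_dirichlet : sobolev_dirichlet VD p u) (lam_gt0 : 0 < lam).
Hypothesis u_norm : forall x, lam * `|u x| = w x.

(** Since [u] has no zero inside an edge, its value at the midpoint carries the sign of the whole
    edge. *)
Let mid e := restr u e (len e / 2).

Lemma restr_neq0 e x : 0 < x < len e -> restr u e x != 0.
Proof.
move=> /restr_torsion_gt0; rewrite /restr -u_norm pmulr_rgt0// normr_gt0.
by [].
Qed.

(** By the intermediate value theorem: between [x] and the midpoint only [x] can be an end of the
    edge, and there [u] is nonzero by assumption. *)
Lemma sign_mid e x : 0 <= x <= len e -> restr u e x != 0 ->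
  (0 < restr u e x) = (0 < mid e).
Proof.
move=> /andP[x0 xl] ux; have l0 := len_gt0 e.
have cu x1 x2 : 0 <= x1 -> x2 <= len e -> {within `[x1, x2], continuous (restr u e)}.
  move=> h1 h2; apply: continuous_subspaceW (u_dirichlet.1 e).2.
  by apply: subset_itv; rewrite bnd_simp.
have noroot x1 x2 : 0 <= x1 -> x1 <= x2 -> x2 <= len e ->
    (forall c, x1 <= c <= x2 -> restr u e c != 0) ->
    (0 < restr u e x1) = (0 < restr u e x2).
  move=> h0 h1 h2 nz; apply/idP/idP => h; rewrite ltNge; apply/negP => h'.
    have [||c] := @IVT _ (restr u e) x1 x2 0 h1; first exact: cu.
      by rewrite ge_min h' orbT le_max (ltW h).
    by rewrite in_itv/= => /nz/eqP.
  have [||c] := @IVT _ (restr u e) x1 x2 0 h1; first exact: cu.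
    by rewrite ge_min h' le_max (ltW h) orbT.
  by rewrite in_itv/= => /nz/eqP.
have [h|h] := leP x (len e / 2).
  apply: noroot => //; first lra.
  move=> c /andP[xc cl]; have [<-//|cx] := eqVneq x c.
  by apply: restr_neq0; rewrite (le_lt_trans x0)/= ?lt_neqAle ?cx//; lra.
symmetry; apply: noroot => //; [lra|lra|].
move=> c /andP[xc cl]; have [->//|cx] := eqVneq c x.
apply: restr_neq0; rewrite (lt_le_trans _ xc) ?divr_gt0//=.
by apply: lt_le_trans xl; rewrite lt_neqAle cx.
Qed.

Let inc e x := (src e == x) || (tgt e == x).

Lemma sign_vertex e x : inc e x -> u (Vertex x) != 0 ->
  (0 < u (Vertex x)) = (0 < mid e).
Proof.
have l0 := ltW (len_gt0 e).
move=> /orP[]/eqP <-; rewrite -?restr_src -?restr_tgt => h.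
  by apply: sign_mid; rewrite ?lexx.
by apply: sign_mid; rewrite ?lexx ?l0.
Qed.

(* At a Dirichlet vertex [u] vanishes, but only one edge ends there. *)
Lemma sign_coherent e1 e2 x : inc e1 x -> inc e2 x -> (0 < mid e1) = (0 < mid e2).
Proof.
move=> i1 i2; have [xVD|xVD] := boolP (x \in VD); last first.
  have ux : u (Vertex x) != 0.
    by have := torsion_vertex_gt0 xVD; rewrite -u_norm pmulr_rgt0// normr_gt0.
  by rewrite -(sign_vertex i1 ux) (sign_vertex i2 ux).
suff -> : e1 = e2 by [].
have := VD_degree1 xVD; rewrite /degree.
set S1 := [set _ | _]%SET; set S2 := [set _ | _]%SET => d.
have c1 : (#|(S1 :|: S2)%SET| <= 1)%N by rewrite -d leq_card_setU.
by apply: (card_le1_eqP c1); rewrite !inE.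
Qed.

Lemma proportional : exists2 c : R, c != 0 & forall x, u x = c * w x.
Proof.
have [x0 _] := VD_nonempty; have [e0 ie0] := incident_edge x0.
(* By [sign_coherent] all edges at [x] have the same sign, so a single one decides [P x], and [P]
   passes from one end of an edge to the other. *)
pose P x := [exists e, inc e x && ((0 < mid e) == (0 < mid e0))].
have Pinc e x : inc e x -> P x = ((0 < mid e) == (0 < mid e0)).
  move=> ie; apply/existsP/idP => [[e1 /andP[ie1 /eqP <-]]|he].
    by apply/eqP; exact: sign_coherent ie ie1.
  by exists e; rewrite ie.
have PT x : P x.
  have cl : fingraph.closed (@Defs.adjacent R G) P.
    move=> x1 x2 /existsP[e h]; rewrite /in_mem/=.
    have [i1 i2] : inc e x1 /\ inc e x2.
      by case/orP: h => /andP[/eqP <- /eqP <-]; rewrite /inc !eqxx ?orbT.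
    by rewrite (Pinc _ _ i1) (Pinc _ _ i2).
  have := closed_connect cl (G_connected x0 x); rewrite /in_mem/= => <-.
  by rewrite (Pinc _ _ ie0).
have sgn e : (0 < mid e) = (0 < mid e0).
  by apply/eqP; rewrite -(@Pinc e (src e)) ?PT// /inc eqxx.
pose c : R := (if 0 < mid e0 then 1 else -1) / lam.
(* The sign is required only where [u] is nonzero; at a zero [u_norm] gives [w x = 0], which covers
   the Dirichlet vertices. *)
have key x : (u x != 0 -> (0 < u x) = (0 < mid e0)) -> u x = c * w x.
  have lam0 : lam != 0 by rewrite gt_eqF.
  rewrite -u_norm /c => h; rewrite mulrA mulfVK//.
  have [->|ux] := eqVneq (u x) 0; first by rewrite normr0 mulr0.
  rewrite -(h ux); case: ltrP => [?|ux']; first by rewrite mul1r gtr0_norm.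
  by rewrite ler0_norm// mulN1r opprK.
exists c.
  apply: mulf_neq0; last by rewrite invr_neq0 ?gt_eqF.
  by case: ifP => _; rewrite ?oppr_eq0 oner_eq0.
case=> [x|e y]; apply: key => ux.
  by have [e ie] := incident_edge x; rewrite (sign_vertex ie ux) sgn.
rewrite -restr_interior in ux *; rewrite sign_mid ?sgn//.
by have /andP[? ?] := valP y; apply/andP; split; exact: ltW.
Qed.

End Sign.

End Extremals.

Theorem proposition3p5 (R : realType) (G : metric_graph R)
  (VD : {set vertex G}) (p : R) (w : graph_point G -> R)
  (G_connected : connected_graph G)
  (VD_nonempty : exists v, v \in VD)
  (VD_degree1 : forall v, v \in VD -> degree v = 1%N)
  (p_gt1 : 1 < p)
  (w_torsion : is_torsion_function VD p w) :
  let S := ereal_sup [set (torsion_quotient p u)%:E | u in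
             [set u : graph_point G -> R |
                sobolev_dirichlet VD p u /\ exists x, u x <> 0]] in
  (torsional_rigidity p w)%:E = S /\
  forall u : graph_point G -> R,
    sobolev_dirichlet VD p u -> (exists x, u x <> 0) ->
    ((torsion_quotient p u)%:E = S <->
     exists c : R, c != 0 /\ forall x, u x = c * w x).
Proof.
move=> S; have [a flux] := torsion_flux_exists w_torsion.
have quot_le u := quotient_le G_connected p_gt1 VD_nonempty VD_degree1 w_torsion
  flux (u := u).
have quot_scale u c := quotient_scale G_connected p_gt1 VD_nonempty VD_degree1
  w_torsion flux (u := u) (c := c).
have SE : (torsional_rigidity p w)%:E = S.
  apply/eqP; rewrite eq_le; apply/andP; split; last first.
    apply: ge_ereal_sup => _ [u [du _] <-]; rewrite lee_fin.
    exact: (quot_le u du).1.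
  apply: ereal_sup_ubound; exists w; last first.
    congr (_%:E); apply: (quot_scale w 1); rewrite ?oner_eq0//.
      by have [] := w_torsion.
    by move=> x; rewrite mul1r.
  split; first by have [] := w_torsion.
  have [x0 _] := VD_nonempty; have [e _] := incident_edge G_connected VD_nonempty
    VD_degree1 x0.
  (* [w] is admissible because it is positive at the midpoint of an edge. *)
  exists (edge_pt e (len e / 2)); apply/eqP.
  have lh : 0 < len e / 2 < len e by have := len_gt0 e; lra.
  by rewrite gt_eqF// (restr_torsion_gt0 G_connected p_gt1 VD_nonempty w_torsion flux lh).
split=> // u du _; rewrite -SE; split=> [[] eqq|[c [c0 uw]]]; last first.
  by congr (_%:E); exact: quot_scale du c0 uw.
have [lam lam0 ulam] := (quot_le u du).2 eqq.
have [c c0 uw] := proportional G_connected p_gt1 VD_nonempty VD_degree1 w_torsion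
  flux du lam0 ulam.
by exists c.
Qed.
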